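(* Let $\gamma_1,\gamma_2,\gamma_3,\delta_1,\delta_2,\delta_3,x,y\in\mathbb{C}$ with $\operatorname{Re}\delta_1>\operatorname{Re}\gamma_1>0$, and let $\alpha_1,\alpha_2,\alpha_4,\beta_1,\beta_2,\beta_4$ be positive real numbers. Then $$D_1\left(\begin{matrix}\gamma_1,\alpha_1,\beta_1;\gamma_2,\alpha_2;\gamma_3,\beta_2;\\ \delta_1,\alpha_1,\beta_1;\delta_2,\alpha_4;\delta_3,\beta_4;\end{matrix}\left|\begin{matrix}x\\ y\end{matrix}\right.\right)=\frac{1}{\Gamma(\gamma_1)\Gamma(\delta_1-\gamma_1)}\int_0^1\xi^{\gamma_1-1}(1-\xi)^{\delta_1-\gamma_1-1}E\left(\begin{matrix}\gamma_2,\alpha_2;\\ \delta_2,\alpha_4;\end{matrix}\,x\xi^{\alpha_1}\right)E\left(\begin{matrix}\gamma_3,\beta_2;\\ \delta_3,\beta_4;\end{matrix}\,y\xi^{\beta_1}\right)d\xi.$$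
   Context: $(\gamma)_\lambda=\Gamma(\gamma+\lambda)/\Gamma(\gamma)$ for $\gamma\in\mathbb{C}$ and real $\lambda\ge0$. For complex $\gamma_i,\delta_i,x,y$ and positive real $\alpha_i,\beta_i$, $$D_1\left(\begin{matrix}\gamma_1,\alpha_1,\beta_1;\gamma_2,\alpha_2;\gamma_3,\beta_2;\\ \delta_1,\alpha_3,\beta_3;\delta_2,\alpha_4;\delta_3,\beta_4;\end{matrix}\left|\begin{matrix}x\\ y\end{matrix}\right.\right)=\sum_{m,n=0}^{\infty}\frac{(\gamma_1)_{\alpha_1 m+\beta_1 n}(\gamma_2)_{\alpha_2 m}(\gamma_3)_{\beta_2 n}}{\Gamma(\delta_1+\alpha_3 m+\beta_3 n)}\frac{x^m}{\Gamma(\delta_2+\alpha_4 m)}\frac{y^n}{\Gamma(\delta_3+\beta_4 n)}.$$ The one-variable Mittag-Leffler-type function is $$E\left(\begin{matrix}\gamma,a;\\ \delta,b;\end{matrix}\,z\right)=\sum_{m=0}^\infty\frac{(\gamma)_{am}\,z^m}{\Gamma(\delta+bm)}.$$ The functions are considered at arguments in the region of absolute convergence of their defining series. *)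

(* Defs.v *)
From HB Require Import structures.
From mathcomp Require Import all_boot all_order all_algebra.
From mathcomp Require Import complex.
From mathcomp Require Import all_classical all_reals all_analysis.

Set Implicit Arguments.
Unset Strict Implicit.
Unset Printing Implicit Defensive.

Import Order.TTheory GRing.Theory Num.Theory.
Import numFieldNormedType.Exports.

Local Open Scope classical_set_scope.
Local Open Scope ring_scope.
Local Open Scope complex_scope.

(* The complex numbers are R[i], for R : realType. R[i] is not equipped with
   measure-theoretic structure, so complex Lebesgue integrals and sums of
   absolutely convergent families are taken on real and imaginary parts. *)

Definition cintegrable (R : realType) (D : set R) (f : R -> R[i]) : Prop :=
  (@lebesgue_measure R).-integrable D (EFin \o (fun t => complex.Re (f t))) /\
  (@lebesgue_measure R).-integrable D (EFin \o (fun t => complex.Im (f t))).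

Definition cintegral (R : realType) (D : set R) (f : R -> R[i]) : R[i] :=
  Rintegral (@lebesgue_measure R) D (fun t => complex.Re (f t)) +i*
  Rintegral (@lebesgue_measure R) D (fun t => complex.Im (f t)).

Definition abs_summable (R : realType) (T : choiceType) (a : T -> R[i]) : Prop :=
  summable [set: T] (fun p => (complex.Re `|a p|)%:E).

Definition rsum (R : realType) (T : choiceType) (f : T -> R) : R :=
  fine (\esum_(p in [set: T]) (Num.max (f p) 0)%:E) -
  fine (\esum_(p in [set: T]) (Num.max (- f p) 0)%:E).

(* Unordered sum; meaningful only for families that are abs_summable. *)
Definition csum (R : realType) (T : choiceType) (a : T -> R[i]) : R[i] :=
  rsum (fun p => complex.Re (a p)) +i* rsum (fun p => complex.Im (a p)).

(* t ^ z = exp (z ln t), for t > 0 *)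
Definition cpow (R : realType) (t : R) (z : R[i]) : R[i] :=
  (expR (complex.Re z * ln t))%:C *
  (cos (complex.Im z * ln t) +i* sin (complex.Im z * ln t)).

Definition euler_integral (R : realType) (z : R[i]) : R[i] :=
  cintegral `]0, +oo[ (fun t : R => cpow t (z - 1) * (expR (- t))%:C).

(* Euler's integral for Re z > 0, continued to Re z <= 0 by
   Gamma z = Gamma (z + n) / (z (z + 1) ... (z + n - 1)), where n is the least
   natural number such that Re (z + n) > 0. At a pole the denominator vanishes
   and _ / 0 = 0, hence Gamma z = 0 there, so that (Gamma z)^-1 = 0 is the
   value of the entire function 1 / Gamma at every pole. *)
Definition Gamma (R : realType) (z : R[i]) : R[i] :=
  if 0 < complex.Re z then euler_integral z
  else let n := (Num.truncn (- complex.Re z)).+1 in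
       euler_integral (z + n%:R) / \prod_(i < n) (z + i%:R).

(* Gamma (g + l) / Gamma g. If g is a pole and l a natural number, this ratio is
   read as its limit, the rising factorial, so that e.g. (g)_0 = 1 for all g;
   if g is a pole and l is not a natural number, the ratio is 0. *)
Definition pochhammer (R : realType) (g : R[i]) (l : R) : R[i] :=
  if `[< exists k : nat, g = - k%:R >] && (l \is a Num.nat)
  then \prod_(i < Num.truncn l) (g + i%:R)
  else Gamma (g + l%:C) / Gamma g.

Definition D1_term (R : realType)
    (gamma1 : R[i]) (alpha1 beta1 : R) (gamma2 : R[i]) (alpha2 : R)
    (gamma3 : R[i]) (beta2 : R)
    (delta1 : R[i]) (alpha3 beta3 : R) (delta2 : R[i]) (alpha4 : R)
    (delta3 : R[i]) (beta4 : R) (x y : R[i]) (p : nat * nat) : R[i] :=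
  let: (m, n) := p in
  pochhammer gamma1 (alpha1 * m%:R + beta1 * n%:R) *
  pochhammer gamma2 (alpha2 * m%:R) * pochhammer gamma3 (beta2 * n%:R) /
  Gamma (delta1 + (alpha3 * m%:R + beta3 * n%:R)%:C) *
  (x ^+ m / Gamma (delta2 + (alpha4 * m%:R)%:C)) *
  (y ^+ n / Gamma (delta3 + (beta4 * n%:R)%:C)).

Definition D1 (R : realType)
    (gamma1 : R[i]) (alpha1 beta1 : R) (gamma2 : R[i]) (alpha2 : R)
    (gamma3 : R[i]) (beta2 : R)
    (delta1 : R[i]) (alpha3 beta3 : R) (delta2 : R[i]) (alpha4 : R)
    (delta3 : R[i]) (beta4 : R) (x y : R[i]) : R[i] :=
  csum (D1_term gamma1 alpha1 beta1 gamma2 alpha2 gamma3 beta2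
                delta1 alpha3 beta3 delta2 alpha4 delta3 beta4 x y).

Definition ML_term (R : realType) (g : R[i]) (a : R) (d : R[i]) (b : R)
    (z : R[i]) (m : nat) : R[i] :=
  pochhammer g (a * m%:R) * z ^+ m / Gamma (d + (b * m%:R)%:C).

Definition ML (R : realType) (g : R[i]) (a : R) (d : R[i]) (b : R)
    (z : R[i]) : R[i] :=
  csum (ML_term g a d b z).

(* Main.v *)
Require Import Defs.
From HB Require Import structures.
From mathcomp Require Import all_boot all_order all_algebra.
From mathcomp Require Import complex.
From mathcomp Require Import all_classical all_reals all_analysis.
From mathcomp Require Import measurable_realfun ring lra.

Set Implicit Arguments.
Unset Strict Implicit.
Unset Printing Implicit Defensive.

Import Order.TTheory GRing.Theory Num.Theory.
Import numFieldNormedType.Exports ComplexField.Normc.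

Local Open Scope classical_set_scope.
Local Open Scope ring_scope.
Local Open Scope complex_scope.

(** Put q = delta1 - gamma1 and, for a pair (m, n), s = alpha1 m + beta1 n.
Because (gamma1 + s) + q = delta1 + s, Euler's Beta integral gives
  Gamma (gamma1 + s) / Gamma (delta1 + s) = B (gamma1 + s, q) / Gamma q,
and B (gamma1 + s, q) is the integral over ]0, 1[ of
xi^(gamma1 - 1) (1 - xi)^(q - 1) xi^(alpha1 m) xi^(beta1 n).
Up to the constant 1 / (Gamma gamma1 Gamma q), the (m, n) term of the double
series is therefore the integral of the weight times the m-th term of the first
Mittag-Leffler series at x xi^alpha1 and the n-th term of the second one at
y xi^beta1. For fixed xi these products sum to the product of the two series
([csumM]), so the theorem amounts to exchanging the sum over (m, n) with the
integral over xi ([csum_cintegral]).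

The exchange requires the sum of the integrals of the moduli to be finite. These
integrals contain Gamma (Re gamma1 + s) / Gamma (Re delta1 + s), whereas absolute
convergence of the double series only controls the modulus of
Gamma (gamma1 + s) / Gamma (delta1 + s). The two are comparable, uniformly in s
([beta_abs_le]): |Gamma z| <= 2 Gamma (Re z) is clear from Euler's integral, and
conversely |Gamma (a + iy)| >= c Gamma a with one c > 0 for all a >= x0 > 0
([normc_Gamma_ge]). For large a this holds because, under the probability density
t^(a-1) e^(-t) / Gamma a, the variable ln t concentrates near ln a, so that the
oscillating factor t^(iy) is on average close to a^(iy)
([normc_Gamma_ge_large]); the functional equation carries the bound down to x0.
The same bound shows that Gamma has no zero with positive real part, so that the
quotients above may be cancelled.

The identity Gamma p Gamma q = B (p, q) Gamma (p + q) ([Gamma_Beta]) comes from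
integrating s^(p-1) (u - s)^(q-1) e^(-u) over 0 < s < u in both orders: the
translation u = s + t gives the left-hand side, the dilation s = u xi the right-hand
side. Its case q = 1 is the functional equation, since B (z, 1) = 1 / z. *)

(** * Complex numbers *)

Lemma ReM (R : realType) (a b : R[i]) :
  complex.Re (a * b) = complex.Re a * complex.Re b - complex.Im a * complex.Im b.
Proof. by case: a => a1 a2; case: b => b1 b2. Qed.

Lemma ImM (R : realType) (a b : R[i]) :
  complex.Im (a * b) = complex.Re a * complex.Im b + complex.Im a * complex.Re b.
Proof. by case: a => a1 a2; case: b => b1 b2; rewrite /= addrC. Qed.

Lemma complexEta (R : realType) (a : R[i]) :
  a = complex.Re a +i* complex.Im a.
Proof. by case: a. Qed.

Lemma ler_Re_normc (R : realType) (a : R[i]) : `|complex.Re a| <= normc a.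
Proof.
case: a => a b /=; rewrite -sqrtr_sqr ler_wsqrtr// lerDl; exact: sqr_ge0.
Qed.

Lemma ler_Im_normc (R : realType) (a : R[i]) : `|complex.Im a| <= normc a.
Proof.
case: a => a b /=; rewrite -sqrtr_sqr ler_wsqrtr// lerDr; exact: sqr_ge0.
Qed.

Lemma normc_ler_ReIm (R : realType) (a : R[i]) :
  normc a <= `|complex.Re a| + `|complex.Im a|.
Proof.
case: a => a b /=; rewrite -[leRHS]ger0_norm ?addr_ge0// -sqrtr_sqr.
apply: ler_wsqrtr; rewrite sqrrD !real_normK ?num_real// lerD2r lerDl.
by rewrite mulrn_wge0// mulr_ge0.
Qed.

Lemma normc_ge0 (R : realType) (a : R[i]) : 0 <= normc a.
Proof. by case: a => a b; exact: sqrtr_ge0. Qed.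

Lemma normc_realC (R : realType) (a : R) : normc a%:C = `|a|.
Proof. by rewrite /= expr0n addr0 sqrtr_sqr. Qed.

Lemma ReD (R : realType) (a b : R[i]) :
  complex.Re (a + b) = complex.Re a + complex.Re b.
Proof. by case: a => a1 a2; case: b. Qed.

Lemma ReB (R : realType) (a b : R[i]) :
  complex.Re (a - b) = complex.Re a - complex.Re b.
Proof. by case: a => a1 a2; case: b. Qed.

(** * Unordered sums *)

Section real_sums.
Context {R : realType} {T : choiceType}.
Implicit Types f g : T -> R.

Definition rsummable f := summable [set: T] (fun p => (f p)%:E).

Lemma rsummable_le f g : (forall p, `|f p| <= `|g p|) ->
  rsummable g -> rsummable f.
Proof. by move=> fg; apply: le_lt_trans; apply: le_esum => p _; rewrite lee_fin. Qed.

Lemma rsummableD f g : rsummable f -> rsummable g -> rsummable (f \+ g).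
Proof. by move=> sf sg; exact: summableD sf sg. Qed.

Lemma esumZ k f : 0 <= k -> (forall p, 0 <= f p) ->
  (\esum_(p in [set: T]) (k * f p)%:E =
   k%:E * \esum_(p in [set: T]) (f p)%:E)%E.
Proof.
have le_ k' g : 0 <= k' -> (forall p, 0 <= g p) ->
    (\esum_(p in [set: T]) (k' * g p)%:E <=
     k'%:E * \esum_(p in [set: T]) (g p)%:E)%E.
  move=> k0 g0; apply: ge_ereal_sup => _ /= [X [finX _]] <-.
  under eq_fsbigr do rewrite EFinM.
  rewrite -ge0_mule_fsumr; last by move=> p; rewrite lee_fin.
  by apply: lee_wpmul2l; rewrite ?lee_fin//; apply: ereal_sup_ubound; exists X.
move=> k0 f0; have [->|kn0] := eqVneq k 0.
  by rewrite mul0e esum1// => p _; rewrite mul0r.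
have kp : 0 < k by rewrite lt_neqAle eq_sym kn0.
apply/eqP; rewrite eq_le le_//=.
rewrite -lee_pdivlMl//.
have -> : \esum_(p in [set: T]) (f p)%:E =
    \esum_(p in [set: T]) (k^-1 * (k * f p))%:E.
  by apply: eq_esum => p _; rewrite mulKf.
by apply: le_ => //[|p]; rewrite ?invr_ge0 ?mulr_ge0.
Qed.

Lemma rsummable_fin f : (forall p, 0 <= f p) -> rsummable f ->
  \esum_(p in [set: T]) (f p)%:E \is a fin_num.
Proof.
move=> f0; rewrite /rsummable summableE; congr (_ \is a fin_num).
by apply: eq_esum => p _; rewrite gee0_abs// lee_fin.
Qed.

Lemma rsummable_ge0 f : (forall p, 0 <= f p) ->
  (\esum_(p in [set: T]) (f p)%:E < +oo)%E -> rsummable f.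
Proof.
move=> f0; apply: le_lt_trans; apply: le_esum => p _.
by rewrite gee0_abs// lee_fin.
Qed.

(** Any decomposition of a real family as a difference of nonnegative summable
families computes its sum, not only the one into positive and negative parts. All
algebraic rules for [rsum] are read off from this. *)
Lemma rsum_sub f g : (forall p, 0 <= f p) -> (forall p, 0 <= g p) ->
    rsummable f -> rsummable g ->
  rsum (f \- g) = fine (\esum_(p in [set: T]) (f p)%:E) -
                  fine (\esum_(p in [set: T]) (g p)%:E).
Proof.
move=> f0 g0 sf sg.
have dfg : rsummable (f \- g).
  by apply: rsummableD => //; apply: rsummable_le sg => p; rewrite normrN.
have /(congr1 fine) : (\esum_(p in [set: T]) (Num.max ((f \- g) p) 0)%:E -
    \esum_(p in [set: T]) (Num.max (- (f \- g) p) 0)%:E =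
    \esum_(p in [set: T]) (f p)%:E - \esum_(p in [set: T]) (g p)%:E)%E.
  rewrite -(esumB sf sg); [|by move=> p _; rewrite lee_fin..].
  by congr (_ - _)%E; apply: eq_esum => p _;
    rewrite ?funeposE ?funenegE /= -?EFinD EFin_max.
have max_le (r : R) : `|Num.max r 0| <= `|r|.
  by rewrite ger0_norm ?le_max ?lexx ?orbT// ge_max ler_norm normr_ge0.
move=> E; rewrite /rsum -fineB ?E ?fineB//; apply: rsummable_fin => //.
- by move=> p; rewrite le_max lexx orbT.
- by apply: rsummable_le dfg => p; exact: max_le.
- by move=> p; rewrite le_max lexx orbT.
- by apply: rsummable_le dfg => p; rewrite (le_trans (max_le _))// normrN.
Qed.

End real_sums.

Section real_sums_linear.
Context {R : realType} {T : choiceType}.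
Implicit Types f g : T -> R.

(** Intended for nonnegative summable families, for which no infinity is lost. *)
Definition nnsum f : R := fine (\esum_(p in [set: T]) (f p)%:E).

Lemma nnsumD f g : (forall p, 0 <= f p) -> (forall p, 0 <= g p) ->
  rsummable f -> rsummable g -> nnsum (f \+ g) = nnsum f + nnsum g.
Proof.
move=> f0 g0 sf sg; rewrite /nnsum -fineD ?rsummable_fin//.
by rewrite -esumD// => p _; rewrite lee_fin.
Qed.

Lemma nnsumZ k f : 0 <= k -> (forall p, 0 <= f p) ->
  rsummable f -> nnsum (fun p => k * f p) = k * nnsum f.
Proof. by move=> k0 f0 sf; rewrite /nnsum esumZ// fineM// rsummable_fin. Qed.

Lemma rsummableZ k f : rsummable f -> rsummable (fun p => k * f p).
Proof.
move=> sf; rewrite /rsummable /summable.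
under eq_esum do rewrite /= normrM.
rewrite esumZ// lte_mul_pinfty ?lee_fin//.
Qed.

Definition pos_part f p := Num.max (f p) 0.
Definition neg_part f p := Num.max (- f p) 0.

Lemma pos_ge0 f p : 0 <= pos_part f p.
Proof. by rewrite le_max lexx orbT. Qed.

Lemma neg_ge0 f p : 0 <= neg_part f p.
Proof. by rewrite le_max lexx orbT. Qed.

Lemma pos_neg f p : f p = pos_part f p - neg_part f p.
Proof. by rewrite /pos_part /neg_part; case: (leP (f p) 0); case: (leP (- f p) 0); lra. Qed.

Lemma pos_le f p : `|pos_part f p| <= `|f p|.
Proof.
by rewrite ger0_norm ?pos_ge0// /pos_part ge_max ler_norm normr_ge0.
Qed.

Lemma neg_le f p : `|neg_part f p| <= `|f p|.
Proof.
by rewrite ger0_norm ?neg_ge0// /neg_part ge_max -normrN ler_norm normr_ge0.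
Qed.

Lemma rsummable_pos f : rsummable f -> rsummable (pos_part f).
Proof. by apply: rsummable_le; exact: pos_le. Qed.

Lemma rsummable_neg f : rsummable f -> rsummable (neg_part f).
Proof. by apply: rsummable_le; exact: neg_le. Qed.

Lemma rsumE f : rsum f = nnsum (pos_part f) - nnsum (neg_part f).
Proof. by []. Qed.

Hint Resolve pos_ge0 neg_ge0 rsummable_pos rsummable_neg : core.

Lemma rsumB_nnsum f g h : (forall p, 0 <= f p) -> (forall p, 0 <= g p) ->
    rsummable f -> rsummable g -> (forall p, h p = f p - g p) ->
  rsum h = nnsum f - nnsum g.
Proof. by move=> f0 g0 sf sg /funext ->; exact: rsum_sub. Qed.

Lemma rsumD f g : rsummable f -> rsummable g ->
  rsum (fun p => f p + g p) = rsum f + rsum g.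
Proof.
move=> sf sg.
rewrite (@rsumB_nnsum (pos_part f \+ pos_part g) (neg_part f \+ neg_part g)).
- by rewrite !nnsumD//; [rewrite !rsumE; lra|auto..].
- by move=> p /=; rewrite addr_ge0.
- by move=> p /=; rewrite addr_ge0.
- by apply: rsummableD; auto.
- by apply: rsummableD; auto.
- by move=> p /=; rewrite {1}(pos_neg f) {1}(pos_neg g); lra.
Qed.

Lemma rsumZ k f : rsummable f -> rsum (fun p => k * f p) = k * rsum f.
Proof.
move=> sf; have [k0|k0] := leP 0 k.
  rewrite (@rsumB_nnsum (fun p => k * pos_part f p) (fun p => k * neg_part f p)).
  - by rewrite !nnsumZ//; [rewrite rsumE; lra|auto..].
  - by move=> p; rewrite mulr_ge0.
  - by move=> p; rewrite mulr_ge0.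
  - by apply: rsummableZ; auto.
  - by apply: rsummableZ; auto.
  - by move=> p; rewrite {1}(pos_neg f); lra.
have k1 : 0 <= - k by lra.
rewrite (@rsumB_nnsum (fun p => (- k) * neg_part f p) (fun p => (- k) * pos_part f p)).
- by rewrite !nnsumZ//; [rewrite rsumE; lra|auto..].
- by move=> p; rewrite mulr_ge0.
- by move=> p; rewrite mulr_ge0.
- by apply: rsummableZ; auto.
- by apply: rsummableZ; auto.
- by move=> p; rewrite {1}(pos_neg f); lra.
Qed.

Lemma rsumB f g : rsummable f -> rsummable g ->
  rsum (fun p => f p - g p) = rsum f - rsum g.
Proof.
move=> sf sg; have -> : (fun p => f p - g p) = (fun p => f p + (-1) * g p).
  by apply/funext => p; rewrite mulN1r.
by rewrite rsumD ?rsumZ ?mulN1r//; exact: rsummableZ.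
Qed.

End real_sums_linear.

#[global] Hint Resolve pos_ge0 neg_ge0 rsummable_pos rsummable_neg : core.

Section real_sums_product.
Context {R : realType} {T1 T2 : choiceType}.
Implicit Types (f : T1 -> R) (g : T2 -> R).

Lemma esum_prod f g : (forall p, 0 <= f p) -> (forall p, 0 <= g p) ->
    rsummable g ->
  (\esum_(p in [set: T1 * T2]) (f p.1 * g p.2)%:E =
   (nnsum g)%:E * \esum_(p in [set: T1]) (f p)%:E)%E.
Proof.
move=> f0 g0 sg; rewrite -setXTT.
have -> : [set: T1] `*` [set: T2] = [set: T1] `*`` (fun=> [set: T2]) by [].
rewrite -(@esum_esum _ _ _ _ _ (fun i j => (f i * g j)%:E)); last first.
  by move=> i j _ _; rewrite lee_fin mulr_ge0.
under eq_esum do rewrite esumZ// -(fineK (rsummable_fin g0 sg)) muleC -EFinM.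
by rewrite esumZ// fine_ge0// esum_ge0// => p _; rewrite lee_fin.
Qed.

Lemma rsummable_prod f g : rsummable f -> rsummable g ->
  rsummable (fun p : T1 * T2 => f p.1 * g p.2).
Proof.
move=> sf sg; rewrite /rsummable /summable.
under eq_esum do rewrite /= normrM.
rewrite (@esum_prod (fun p => `|f p|) (fun p => `|g p|))//; last first.
  by apply: rsummable_le sg => p; rewrite normr_id.
by rewrite lte_mul_pinfty ?lee_fin// fine_ge0// esum_ge0.
Qed.

Lemma nnsum_prod f g : (forall p, 0 <= f p) -> (forall p, 0 <= g p) ->
    rsummable f -> rsummable g ->
  nnsum (fun p : T1 * T2 => f p.1 * g p.2) = nnsum f * nnsum g.
Proof.
move=> f0 g0 sf sg; rewrite /nnsum esum_prod// fineM ?rsummable_fin//.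
by rewrite mulrC.
Qed.

(** Expanding (f+ - f-)(g+ - g-) writes the product family as a difference of
nonnegative ones, to which the nonnegative case applies. *)
Lemma rsum_prod f g : rsummable f -> rsummable g ->
  rsum (fun p : T1 * T2 => f p.1 * g p.2) = rsum f * rsum g.
Proof.
move=> sf sg.
have pr0 (a : T1 -> R) (b : T2 -> R) : (forall p, 0 <= a p) ->
    (forall p, 0 <= b p) -> forall p : T1 * T2, 0 <= a p.1 * b p.2.
  by move=> a0 b0 p; rewrite mulr_ge0.
rewrite (@rsumB_nnsum _ _
  ((fun p => pos_part f p.1 * pos_part g p.2) \+ (fun p => neg_part f p.1 * neg_part g p.2))
  ((fun p => pos_part f p.1 * neg_part g p.2) \+ (fun p => neg_part f p.1 * pos_part g p.2))).
- rewrite !nnsumD; try (by apply: pr0; auto);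
    try (by apply: rsummable_prod; auto).
  by rewrite !nnsum_prod; auto; rewrite !rsumE; lra.
- by move=> p; rewrite addr_ge0//; exact: pr0.
- by move=> p; rewrite addr_ge0//; exact: pr0.
- by apply: rsummableD; apply: rsummable_prod; auto.
- by apply: rsummableD; apply: rsummable_prod; auto.
- by move=> p /=; rewrite {1}(pos_neg f) {1}(pos_neg g); lra.
Qed.

End real_sums_product.

Section complex_sums.
Context {R : realType}.

Lemma abs_summable_Re (T : choiceType) (a : T -> R[i]) : abs_summable a ->
  rsummable (fun p => complex.Re (a p)).
Proof.
apply: rsummable_le => p; rewrite [leRHS]ger0_norm; exact: ler_Re_normc || exact: normc_ge0.
Qed.

Lemma abs_summable_Im (T : choiceType) (a : T -> R[i]) : abs_summable a ->
  rsummable (fun p => complex.Im (a p)).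
Proof.
apply: rsummable_le => p; rewrite [leRHS]ger0_norm; exact: ler_Im_normc || exact: normc_ge0.
Qed.

Lemma csumZ (T : choiceType) (c : R[i]) (a : T -> R[i]) : abs_summable a ->
  csum (fun p => c * a p) = c * csum a.
Proof.
move=> sa; have sR := abs_summable_Re sa; have sI := abs_summable_Im sa.
rewrite [RHS]complexEta ReM ImM /csum /=; congr (_ +i* _).
  under eq_fun do rewrite ReM.
  by rewrite rsumB ?rsumZ//; exact: rsummableZ.
under eq_fun do rewrite ImM.
by rewrite rsumD ?rsumZ//; exact: rsummableZ.
Qed.

Lemma csumM (T1 T2 : choiceType) (a : T1 -> R[i]) (b : T2 -> R[i]) :
    abs_summable a -> abs_summable b ->
  csum (fun p : T1 * T2 => a p.1 * b p.2) = csum a * csum b.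
Proof.
move=> sa sb.
have [aR aI] := (abs_summable_Re sa, abs_summable_Im sa).
have [bR bI] := (abs_summable_Re sb, abs_summable_Im sb).
rewrite [RHS]complexEta ReM ImM /csum /=; congr (_ +i* _).
  under eq_fun do rewrite ReM.
  rewrite -(rsum_prod aR bR) -(rsum_prod aI bI) -rsumB//.
    exact: (rsummable_prod aR bR).
  exact: (rsummable_prod aI bI).
under eq_fun do rewrite ImM.
rewrite -(rsum_prod aR bI) -(rsum_prod aI bR) -rsumD//.
  exact: (rsummable_prod aR bI).
exact: (rsummable_prod aI bR).
Qed.

Lemma abs_summableM (T1 T2 : choiceType) (a : T1 -> R[i]) (b : T2 -> R[i]) :
    abs_summable a -> abs_summable b ->
  abs_summable (fun p : T1 * T2 => a p.1 * b p.2).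
Proof.
move=> sa sb; rewrite /abs_summable.
rewrite (_ : (fun p => _) = (fun p : T1 * T2 =>
  (normc (a p.1) * normc (b p.2))%:E)); first exact: (rsummable_prod sa sb).
by apply/funext => p; rewrite -normcM.
Qed.

Lemma abs_summableZ (T : choiceType) (c : R[i]) (a : T -> R[i]) :
  abs_summable a -> abs_summable (fun p => c * a p).
Proof.
move=> sa; rewrite /abs_summable.
rewrite (_ : (fun p => _) = (fun p => (normc c * normc (a p))%:E)).
  exact: (rsummableZ _ sa).
by apply/funext => p; rewrite -normcM.
Qed.

End complex_sums.

(** * Integrating a sum termwise *)

Section sum_integral.
Context {d : measure_display} {X : measurableType d} {R : realType}.
Variables (mu : {measure set X -> \bar R}) (T : countType) (D : set X).
Hypothesis mD : measurable D.

(** An enumeration of the index type turns an unordered sum into a series, for which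
measurability and monotone convergence are available. *)
Lemma esum_pickle (a : T -> \bar R) : (forall p, 0 <= a p)%E ->
  (\esum_(p in [set: T]) a p = \sum_(n <oo) oapp a 0 (pickle_inv n))%E.
Proof.
move=> a0; rewrite nneseries_esumT; last by move=> n; case: pickle_inv => /=.
rewrite (_ : \esum_(n in [set: nat]) _ =
  \esum_(n in range (@pickle T)) oapp a 0%E (pickle_inv n)); last first.
  rewrite [RHS]esum_mkcond; apply: eq_esum => n _.
  case: ifPn => //; case E : (pickle_inv n) => [p|//] /negP[].
  by rewrite inE; exists p => //; have := @pickle_invK T n; rewrite E.
rewrite (@reindex_esum _ _ _ [set: T] _ (@pickle T)); last by split.
by apply: eq_esum => p _; rewrite pickleK_inv.
Qed.

Lemma measurable_esum (f : T -> X -> \bar R) :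
    (forall p, measurable_fun D (f p)) -> (forall p x, 0 <= f p x)%E ->
  measurable_fun D (fun x => \esum_(p in [set: T]) f p x).
Proof.
move=> mf f0; under eq_fun do rewrite esum_pickle//.
apply: ge0_emeasurable_sum => [n x _ _|n _]; first by case: pickle_inv => /=.
by case: pickle_inv => [p|] //=; exact: measurable_cst.
Qed.

Lemma integral_esum (f : T -> X -> \bar R) :
    (forall p, measurable_fun D (f p)) -> (forall p x, 0 <= f p x)%E ->
  (\int[mu]_(x in D) (\esum_(p in [set: T]) f p x) =
   \esum_(p in [set: T]) \int[mu]_(x in D) f p x)%E.
Proof.
move=> mf f0; under eq_integral do rewrite esum_pickle//.
rewrite integral_nneseries//; last 2 first.
- by move=> n; case: pickle_inv => [p|] //=; exact: measurable_cst.
- by move=> n x _; case: pickle_inv => /=.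
rewrite esum_pickle; last by move=> p; exact: integral_ge0.
by apply: eq_eseriesr => n _; case: pickle_inv => //=; rewrite integral0.
Qed.

Lemma nnsum_integral (g : T -> X -> R) :
    (forall p, measurable_fun D (g p)) -> (forall p x, 0 <= g p x) ->
    (forall x, D x -> rsummable (g^~ x)) ->
    (\esum_(p in [set: T]) \int[mu]_(x in D) (g p x)%:E < +oo)%E ->
  [/\ mu.-integrable D (fun x => (nnsum (g^~ x))%:E),
      rsummable (fun p => Rintegral mu D (g p)) &
      Rintegral mu D (fun x => nnsum (g^~ x)) =
      nnsum (fun p => Rintegral mu D (g p))].
Proof.
move=> mg g0 sg goo.
have mEg p : measurable_fun D (EFin \o g p) by exact/measurable_EFinP.
have E x : x \in D ->
    (nnsum (g^~ x))%:E = \esum_(p in [set: T]) (g p x)%:E.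
  by rewrite inE => Dx; rewrite /nnsum fineK// rsummable_fin//; exact: sg.
have I : (\int[mu]_(x in D) (nnsum (g^~ x))%:E =
    \esum_(p in [set: T]) \int[mu]_(x in D) (g p x)%:E)%E.
  by rewrite -integral_esum//; exact: eq_integral.
have F p : (Rintegral mu D (g p))%:E = (\int[mu]_(x in D) (g p x)%:E)%E.
  rewrite /Rintegral fineK// ge0_fin_numE; last first.
    by apply: integral_ge0 => x _; rewrite lee_fin.
  apply: le_lt_trans goo; apply: esum_ge. exists [set p].
    by split.
  by rewrite fsbig_set1.
have mn : measurable_fun D (fun x => (nnsum (g^~ x))%:E).
  apply: (@eq_measurable_fun _ _ _ _ _
    (fun x => \esum_(p in [set: T]) (g p x)%:E)%E).
    by move=> x /E ->.
  by apply: measurable_esum => // p x; rewrite lee_fin.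
split.
- apply/integrableP; split => //.
  rewrite (eq_integral (fun x => (nnsum (g^~ x))%:E)) ?I//.
  move=> x _; rewrite gee0_abs// lee_fin fine_ge0// esum_ge0// => p _.
  by rewrite lee_fin.
- rewrite /rsummable; apply: rsummable_ge0.
    by move=> p; exact: Rintegral_ge0.
  by under eq_esum do rewrite F.
- rewrite [LHS]/Rintegral I /nnsum; congr fine.
  by apply: eq_esum => p _; rewrite F.
Qed.

(** Fubini for a sum and an integral, from monotone convergence for the positive and
negative parts. Summability is assumed at every point of D, and not just almost
everywhere, so that [rsum] is meaningful at each of them. *)
Lemma rsum_integral (f : T -> X -> R) :
    (forall p, measurable_fun D (f p)) ->
    (forall x, D x -> rsummable (f^~ x)) ->
    (\esum_(p in [set: T]) \int[mu]_(x in D) `|f p x|%:E < +oo)%E ->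
  mu.-integrable D (fun x => (rsum (f^~ x))%:E) /\
  Rintegral mu D (fun x => rsum (f^~ x)) =
  rsum (fun p => Rintegral mu D (f p)).
Proof.
move=> mf sf foo.
pose fp p x := Num.max (f p x) 0; pose fn p x := Num.max (- f p x) 0.
have mp p : measurable_fun D (fp p) by exact: measurable_maxr.
have mn p : measurable_fun D (fn p).
  by apply: measurable_maxr => //; exact: measurable_funN.
have p0 p x : 0 <= fp p x by rewrite le_max lexx orbT.
have n0 p x : 0 <= fn p x by rewrite le_max lexx orbT.
have le_oo (g : T -> X -> R) : (forall p, measurable_fun D (g p)) ->
    (forall p x, 0 <= g p x) -> (forall p x, g p x <= `|f p x|) ->
    (\esum_(p in [set: T]) \int[mu]_(x in D) (g p x)%:E < +oo)%E.
  move=> mg g0 gf; apply: le_lt_trans foo; apply: le_esum => p _.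
  apply: ge0_le_integral => //.
  - by move=> x _; rewrite lee_fin.
  - exact/measurable_EFinP.
  - by apply/measurable_EFinP; exact: measurableT_comp.
  - by move=> x _; rewrite lee_fin.
have pf p x : fp p x <= `|f p x| by rewrite ge_max ler_norm normr_ge0.
have nf p x : fn p x <= `|f p x| by rewrite ge_max -normrN ler_norm normr_ge0.
have [ip sp Ip] := nnsum_integral mp p0 (fun x Dx => rsummable_pos (sf x Dx))
  (le_oo _ mp p0 pf).
have [in_ sn In] := nnsum_integral mn n0 (fun x Dx => rsummable_neg (sf x Dx))
  (le_oo _ mn n0 nf).
have If p : Rintegral mu D (f p) = Rintegral mu D (fp p) - Rintegral mu D (fn p).
  have fi (g : T -> X -> R) : (forall p, measurable_fun D (g p)) ->
    (forall p x, 0 <= g p x) -> (forall p x, g p x <= `|f p x|) ->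
    mu.-integrable D (EFin \o g p).
    move=> mg g0 gf; apply/integrableP; split; first exact/measurable_EFinP.
    apply: le_lt_trans (le_oo g mg g0 gf); apply: esum_ge.
    exists [set p]; first by split.
    rewrite fsbig_set1; apply: ge0_le_integral => //.
    - by do 2 apply: measurableT_comp => //.
    - exact/measurable_EFinP.
    - by move=> x _; rewrite lee_fin (ger0_norm (g0 p x)) lexx.
  rewrite -(RintegralB mD (fi fp mp p0 pf) (fi fn mn n0 nf)).
  by apply: eq_Rintegral => x _; exact: (pos_neg (f^~ x)).
have rE x : rsum (f^~ x) = nnsum (fp^~ x) - nnsum (fn^~ x) by [].
split.
  exact: (integrableB mD ip in_).
rewrite (RintegralB mD ip in_) Ip In; symmetry.
apply: rsumB_nnsum => //.
  by move=> p; apply: Rintegral_ge0 => x _; exact: p0.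
by move=> p; apply: Rintegral_ge0 => x _; exact: n0.
Qed.

End sum_integral.

(** * Complex-valued integrals on the line *)

Section affine_substitution.
Context {R : realType}.
Notation mu := (@lebesgue_measure R).
Variables (a b : R).
Hypothesis a0 : 0 < a.

Let phi (x : R) : R := a * x + b.

Lemma measurable_affine : measurable_fun [set: R] phi.
Proof.
by apply: measurable_funD => //; exact: measurable_funM.
Qed.

Let psi : measurableTypeR R -> measurableTypeR R := phi.

Let mpsi : measurable_fun [set: measurableTypeR R] psi.
Proof. exact: measurable_affine. Qed.

Let push : {measure set (measurableTypeR R) -> \bar R} :=
  measure_function_pushforward__canonical__measure_function_Measure mu mpsi.

(** Both sides are measures in A, and they agree on half-open intervals. *)
Lemma lebesgue_measure_affine (A : set R) : measurable A ->
  mu A = (a%:E * mu (phi @^-1` A))%E.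
Proof.
move=> mA.
have ag0 : 0 <= a by exact: ltW.
pose nu := mscale (NngNum ag0) push.
have nuE B : nu B = (a%:E * mu (phi @^-1` B))%E by [].
rewrite -nuE; apply: lebesgue_measure_unique => //.
move=> X [[c d] _ <-] /=.
transitivity (a%:E * mu (phi @^-1` `]c, d]))%E; last by [].
have -> : phi @^-1` `]c, d] = `](c - b) / a, (d - b) / a]%classic.
  apply/seteqP; split => x /=; rewrite !in_itv/= /phi => /andP[cx xd].
    by rewrite ltr_pdivrMr// ler_pdivlMr// mulrC ltrBlDr cx lerBrDr xd.
  move: cx xd; rewrite ltr_pdivrMr// ler_pdivlMr// mulrC ltrBlDr => ->.
  by rewrite lerBrDr => ->.
rewrite !lebesgue_measure_itv/= !lte_fin ltr_pM2r ?invr_gt0// ltrD2r.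
case: ifPn => _; last by rewrite mule0.
by rewrite -!EFinB -EFinM; congr (_%:E); field; rewrite gt_eqF.
Qed.

Lemma ge0_integral_affine (f : R -> \bar R) : measurable_fun [set: R] f ->
    (forall x, 0 <= f x)%E ->
  (\int[mu]_x f x = a%:E * \int[mu]_x f (phi x))%E.
Proof.
move=> mf f0; have ag0 : 0 <= a by exact: ltW.
rewrite (@eq_measure_integral _ _ _ setT
  (mscale (NngNum ag0) push)) => [|A mA _]; last first.
  exact: lebesgue_measure_affine.
rewrite ge0_integral_mscale//; congr (_ * _)%E.
by rewrite ge0_integral_pushforward.
Qed.

Lemma integrable_affine (f : R -> R) : mu.-integrable setT (EFin \o f) ->
  mu.-integrable setT (EFin \o (f \o phi)).
Proof.
move=> /integrableP[mf foo]; apply/integrableP; split.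
  exact: (measurableT_comp mf measurable_affine).
rewrite ltey; apply/eqP => E; move: foo.
rewrite ge0_integral_affine//; last exact: measurableT_comp.
by rewrite [X in (_ * X)%E]E mulry gtr0_sg// mul1e ltxx.
Qed.

Lemma Rintegral_affine (f : R -> R) : mu.-integrable setT (EFin \o f) ->
  Rintegral mu setT f = a * Rintegral mu setT (f \o phi).
Proof.
move=> fi; have fpi := integrable_affine fi.
have mf := measurable_int _ fi.
pose g := EFin \o (f \o phi).
have EP : (\int[mu]_x (EFin \o f)^\+ x = a%:E * \int[mu]_x g^\+ x)%E.
  rewrite (ge0_integral_affine (measurable_funepos mf) (@funepos_ge0 _ _ _)).
  by congr (_ * _)%E; apply: eq_integral => x _; rewrite !funeposE.
have EN : (\int[mu]_x (EFin \o f)^\- x = a%:E * \int[mu]_x g^\- x)%E.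
  rewrite (ge0_integral_affine (measurable_funeneg mf) (@funeneg_ge0 _ _ _)).
  by congr (_ * _)%E; apply: eq_integral => x _; rewrite !funenegE.
have E : (\int[mu]_x (EFin \o f) x = a%:E * \int[mu]_x g x)%E.
  have gE := integralE mu setT g.
  have fE := integralE mu setT (EFin \o f).
  have gdef := integrable_add_def measurableT fpi.
  by rewrite fE EP EN gE (@muleBr _ a%:E _ _ isT gdef).
by rewrite /Rintegral E fineM// integrable_fin_num.
Qed.

End affine_substitution.

Section complex_measurable.
Context {d : measure_display} {X : measurableType d} {R : realType}.
Implicit Types (D : set X) (f g : X -> R[i]).

Definition cmeasurable D f :=
  measurable_fun D (fun x => complex.Re (f x)) /\
  measurable_fun D (fun x => complex.Im (f x)).

Lemma cmeasurable_normc D f : cmeasurable D f ->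
  measurable_fun D (fun x => normc (f x)).
Proof.
move=> [mR mI].
rewrite (_ : (fun x => _) = (fun x => Num.sqrt
  (complex.Re (f x) ^+ 2 + complex.Im (f x) ^+ 2))); last first.
  by apply/funext => x; case: (f x).
apply: measurableT_comp.
  by apply: continuous_measurable_fun; exact: sqrt_continuous.
by apply: measurable_funD; exact: measurable_funX.
Qed.

Lemma cmeasurableM D f g : cmeasurable D f -> cmeasurable D g ->
  cmeasurable D (fun x => f x * g x).
Proof.
move=> [fR fI] [gR gI]; split.
  under eq_fun do rewrite ReM.
  by apply: measurable_funB; exact: measurable_funM.
under eq_fun do rewrite ImM.
by apply: measurable_funD; exact: measurable_funM.
Qed.

Lemma cmeasurable_realC D (f : X -> R) : measurable_fun D f ->
  cmeasurable D (fun x => (f x)%:C).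
Proof. by move=> mf; split => //=; exact: measurable_cst. Qed.

Lemma cmeasurable_cst D (c : R[i]) : cmeasurable D (fun=> c).
Proof. by split; exact: measurable_cst. Qed.

End complex_measurable.

Lemma cmeasurable_comp {d1 d2 : measure_display} {X : measurableType d1}
    {Y : measurableType d2} {R : realType} (f : Y -> R[i]) (g : X -> Y) :
  cmeasurable [set: Y] f -> measurable_fun [set: X] g ->
  cmeasurable [set: X] (fun x => f (g x)).
Proof.
by move=> [fR fI] mg; split;
  [exact: (measurableT_comp fR mg)|exact: (measurableT_comp fI mg)].
Qed.

Section complex_integral.
Context {R : realType}.
Notation mu := (@lebesgue_measure R).
Implicit Types (D : set (measurableTypeR R)) (f g : R -> R[i]).

Lemma cintegrable_normc D f : measurable D -> cmeasurable D f ->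
  mu.-integrable D (EFin \o (fun x => normc (f x))) -> cintegrable D f.
Proof.
move=> mD [mR mI] fi; split; apply: le_integrable fi => //.
- exact/measurable_EFinP.
- move=> x _; rewrite lee_fin [leRHS]ger0_norm ?normc_ge0//.
  exact: ler_Re_normc.
- exact/measurable_EFinP.
- move=> x _; rewrite lee_fin [leRHS]ger0_norm ?normc_ge0//.
  exact: ler_Im_normc.
Qed.

Lemma cintegrable_cmeasurable D f : cintegrable D f -> cmeasurable D f.
Proof.
by move=> [/integrableP[/measurable_EFinP fR _] /integrableP[/measurable_EFinP fI _]].
Qed.

Lemma normc_integrable D f : measurable D -> cintegrable D f ->
  mu.-integrable D (EFin \o (fun x => normc (f x))).
Proof.
move=> mD fi; have mf := cintegrable_cmeasurable fi.
move: fi => [fR fI].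
have nR := integrable_norm fR; have nI := integrable_norm fI.
have nRI := integrableD mD nR nI.
apply: (le_integrable mD _ _ nRI).
  by apply/measurable_EFinP; exact: cmeasurable_normc.
move=> x _; rewrite lee_fin ger0_norm ?normc_ge0//.
exact: le_trans (normc_ler_ReIm _) (ler_norm _).
Qed.

Lemma eq_cintegral D f g : (forall x, D x -> f x = g x) ->
  cintegral D f = cintegral D g.
Proof.
move=> fg; rewrite /cintegral; congr (_ +i* _);
  by apply: eq_Rintegral => x; rewrite inE => /fg ->.
Qed.

Lemma eq_cintegrable D f g : measurable D -> (forall x, D x -> f x = g x) ->
  cintegrable D f -> cintegrable D g.
Proof.
move=> mD fg [fR fI]; split; [apply: eq_integrable fR|apply: eq_integrable fI];
  by move=> // x; rewrite inE => /fg /= ->.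
Qed.

(** Passage to functions on the whole line that vanish outside D, on which affine
substitutions and Fubini's theorem are stated. *)
Lemma cintegral_extend D f g : (forall x, D x -> g x = f x) ->
  (forall x, ~ D x -> g x = 0) -> cintegral D f = cintegral setT g.
Proof.
move=> gf g0.
have E x : g x = if x \in D then f x else 0.
  by case: ifPn => [|/negP]; rewrite inE; [exact: gf|exact: g0].
rewrite /cintegral; congr (_ +i* _);
  rewrite Rintegral_mkcond; apply: eq_Rintegral => x _; rewrite patchE E;
  by case: ifPn.
Qed.

Lemma cintegrable_extend D f g : measurable D -> (forall x, D x -> g x = f x) ->
  (forall x, ~ D x -> g x = 0) -> cintegrable setT g -> cintegrable D f.
Proof.
move=> mD gf g0 [gR gI].
by apply: (@eq_cintegrable D g) => //; split; exact: integrableS measurableT _ _ _.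
Qed.

Lemma cintegrableZ D c f : measurable D -> cintegrable D f ->
  cintegrable D (fun x => c * f x).
Proof.
move=> mD fi; apply: cintegrable_normc => //.
  apply: cmeasurableM; first exact: cmeasurable_cst.
  exact: cintegrable_cmeasurable.
rewrite (_ : _ \o _ = (fun x => (normc c)%:E * (normc (f x))%:E)%E); last first.
  by apply/funext => x; rewrite /= normcM.
by apply: integrableZl => //; exact: normc_integrable.
Qed.

Lemma cintegralZ D c f : measurable D -> cintegrable D f ->
  cintegral D (fun x => c * f x) = c * cintegral D f.
Proof.
move=> mD [fR fI]; rewrite [RHS]complexEta ReM ImM /cintegral /=.
have ZR k : mu.-integrable D (EFin \o (fun x => k * complex.Re (f x))).
  exact: (integrableZl mD k fR).
have ZI k : mu.-integrable D (EFin \o (fun x => k * complex.Im (f x))).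
  exact: (integrableZl mD k fI).
congr (_ +i* _).
  under eq_Rintegral do rewrite ReM.
  by rewrite RintegralB// !RintegralZl.
under eq_Rintegral do rewrite ImM.
by rewrite RintegralD// !RintegralZl.
Qed.

(** The constant 2 comes from bounding the real and imaginary parts separately; only
comparability up to a constant matters later. *)
Lemma normc_cintegral_le D f : measurable D -> cintegrable D f ->
  normc (cintegral D f) <= 2 * Rintegral mu D (fun x => normc (f x)).
Proof.
move=> mD fi; have ni := normc_integrable mD fi; move: (fi) => [fR fI].
apply: (le_trans (normc_ler_ReIm _)) => /=.
rewrite mulr2n mulrDl mul1r; apply: lerD.
  apply: le_trans (le_normr_Rintegral mD fR) _.
  apply: le_Rintegral => //; first exact: integrable_norm.
  by move=> x _; exact: ler_Re_normc.
apply: le_trans (le_normr_Rintegral mD fI) _.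
apply: le_Rintegral => //; first exact: integrable_norm.
by move=> x _; exact: ler_Im_normc.
Qed.

Lemma cintegral_realC D (f : R -> R) :
  cintegral D (fun x => (f x)%:C) = (Rintegral mu D f)%:C.
Proof.
rewrite /cintegral /=; congr (_ +i* _).
by rewrite /Rintegral integral0.
Qed.

Lemma cintegrable_affine a b f : 0 < a -> cintegrable setT f ->
  cintegrable setT (fun x => f (a * x + b)).
Proof.
by move=> a0 [fR fI]; split; [exact: (integrable_affine b a0 fR)|
  exact: (integrable_affine b a0 fI)].
Qed.

Lemma cintegral_affine a b f : 0 < a -> cintegrable setT f ->
  cintegral setT f = a%:C * cintegral setT (fun x => f (a * x + b)).
Proof.
move=> a0 [fR fI]; rewrite [RHS]complexEta ReM ImM /cintegral /=.
rewrite !mul0r subr0 addr0; congr (_ +i* _).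
  exact: (Rintegral_affine b a0 fR).
exact: (Rintegral_affine b a0 fI).
Qed.

Lemma Rintegral_Fubini (f : R * R -> R) :
    measurable_fun [set: R * R] f ->
    (forall x, mu.-integrable setT (fun y => (f (x, y))%:E)) ->
    (forall y, mu.-integrable setT (fun x => (f (x, y))%:E)) ->
    (mu \x mu)%E.-integrable setT (EFin \o f) ->
  Rintegral mu setT (fun x => Rintegral mu setT (fun y => f (x, y))) =
  Rintegral mu setT (fun y => Rintegral mu setT (fun x => f (x, y))).
Proof.
move=> mf f1 f2 foo; rewrite /Rintegral; congr fine.
under eq_integral do rewrite fineK ?integrable_fin_num//.
under [RHS]eq_integral do rewrite fineK ?integrable_fin_num//.
have F := Fubini foo; exact: F.
Qed.

(** Every section, rather than almost every one, is assumed to be integrable: the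
inner integrals are then finite everywhere. *)
Lemma cintegral_Fubini (f : R * R -> R[i]) :
    cmeasurable [set: R * R] f ->
    (forall x, cintegrable setT (fun y => f (x, y))) ->
    (forall y, cintegrable setT (fun x => f (x, y))) ->
    (mu \x mu)%E.-integrable setT (EFin \o (fun z => normc (f z))) ->
  cintegral setT (fun x => cintegral setT (fun y => f (x, y))) =
  cintegral setT (fun y => cintegral setT (fun x => f (x, y))).
Proof.
move=> mf f1 f2 fi; have [mR mI] := mf.
have le_i (g : R * R -> R) : measurable_fun [set: R * R] g ->
    (forall z, `|g z| <= normc (f z)) ->
    (mu \x mu)%E.-integrable setT (EFin \o g).
  move=> mg gf; apply: le_integrable fi => //; first exact/measurable_EFinP.
  by move=> z _; rewrite lee_fin [leRHS]ger0_norm ?normc_ge0.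
rewrite /cintegral /=; congr (_ +i* _).
  apply: (Rintegral_Fubini (f := fun z => complex.Re (f z))) => //.
  - by move=> x; have [] := f1 x.
  - by move=> y; have [] := f2 y.
  - by apply: le_i => // z; exact: ler_Re_normc.
apply: (Rintegral_Fubini (f := fun z => complex.Im (f z))) => //.
- by move=> x; have [] := f1 x.
- by move=> y; have [] := f2 y.
- by apply: le_i => // z; exact: ler_Im_normc.
Qed.

Lemma csum_cintegral (T : countType) (D : set (measurableTypeR R))
    (f : T -> R -> R[i]) : measurable D ->
    (forall p, cmeasurable D (f p)) ->
    (forall x, D x -> abs_summable (f^~ x)) ->
    (\esum_(p in [set: T]) \int[mu]_(x in D) (normc (f p x))%:E < +oo)%E ->
  cintegrable D (fun x => csum (f^~ x)) /\
  cintegral D (fun x => csum (f^~ x)) = csum (fun p => cintegral D (f p)).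
Proof.
move=> mD mf sf foo.
have mR p := (mf p).1; have mI p := (mf p).2.
have le_oo (g : T -> R -> R) : (forall p, measurable_fun D (g p)) ->
    (forall p x, `|g p x| <= normc (f p x)) ->
    (\esum_(p in [set: T]) \int[mu]_(x in D) `|g p x|%:E < +oo)%E.
  move=> mg gf; apply: le_lt_trans foo; apply: le_esum => p _.
  apply: ge0_le_integral => //.
  - apply/measurable_EFinP.
    by apply: (measurableT_comp (@normr_measurable R setT)); exact: mg.
  - by apply/measurable_EFinP; exact: cmeasurable_normc.
  - by move=> x _; rewrite lee_fin.
have rI (g : T -> R -> R) (mg : forall p, measurable_fun D (g p))
    (gf : forall p x, `|g p x| <= normc (f p x))
    (sg : forall x, D x -> rsummable (g^~ x)) :=
  @rsum_integral _ _ _ mu T D mD g mg sg (le_oo g mg gf).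
have [iR IR] := rI _ mR (fun p x => ler_Re_normc (f p x))
  (fun x Dx => abs_summable_Re (sf x Dx)).
have [iI II] := rI _ mI (fun p x => ler_Im_normc (f p x))
  (fun x Dx => abs_summable_Im (sf x Dx)).
by split; [split|rewrite /cintegral /csum; congr (_ +i* _)].
Qed.

End complex_integral.

(** * Complex powers *)

Section complex_power.
Context {R : realType}.
Implicit Types (z w : R[i]) (s t x : R).

Definition cexp z : R[i] :=
  (expR (complex.Re z))%:C * (cos (complex.Im z) +i* sin (complex.Im z)).

Lemma cexpD z w : cexp (z + w) = cexp z * cexp w.
Proof.
case: z => a b; case: w => c d; rewrite /cexp /= expRD cosD sinD.
apply/eqP; rewrite eq_complex /=; apply/andP; split; apply/eqP; ring.
Qed.

Lemma cexp_realC x : cexp x%:C = (expR x)%:C.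
Proof.
rewrite /cexp /= cos0 sin0.
by apply/eqP; rewrite eq_complex /= !mul0r !mulr0 mulr1 subr0 addr0 !eqxx.
Qed.

Lemma normc_cexp z : normc (cexp z) = expR (complex.Re z).
Proof.
rewrite /cexp normcM normc_realC ger0_norm ?expR_ge0//=.
by rewrite cos2Dsin2 sqrtr1 mulr1.
Qed.

Lemma cpowE t z : cpow t z = cexp (z * (ln t)%:C).
Proof. by rewrite /cpow /cexp ReM ImM /= !mulr0 subr0 add0r. Qed.

Lemma cpowD t z w : cpow t (z + w) = cpow t z * cpow t w.
Proof. by rewrite !cpowE mulrDl cexpD. Qed.

Lemma cpowM s t z : 0 < s -> 0 < t -> cpow (s * t) z = cpow s z * cpow t z.
Proof.
by move=> s0 t0; rewrite !cpowE lnM ?posrE// rmorphD mulrDr cexpD.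
Qed.

Lemma normc_cpow t z : normc (cpow t z) = expR (complex.Re z * ln t).
Proof. by rewrite cpowE normc_cexp ReM /= mulr0 subr0. Qed.

Lemma cpow_realC t x : 0 < t -> cpow t x%:C = (t `^ x)%:C.
Proof.
by move=> t0; rewrite cpowE -rmorphM cexp_realC /powR gt_eqF.
Qed.

(* t ^ (z - 1) on the positive half-line *)
(** The function t^(z-1) on the positive half-line, extended by 0 so that it may be
translated and integrated over the whole line; [cpow] itself is 1 at t <= 0. *)
Definition mellin z t : R[i] := if 0 < t then cpow t (z - 1) else 0.

Definition real_mellin x t : R := if 0 < t then expR ((x - 1) * ln t) else 0.

Lemma real_mellin_ge0 x t : 0 <= real_mellin x t.
Proof. by rewrite /real_mellin; case: ifP => // _; exact: expR_ge0. Qed.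

Lemma normc_mellin z t : normc (mellin z t) = real_mellin (complex.Re z) t.
Proof.
rewrite /mellin /real_mellin; case: ifP => _; last by rewrite normc0.
by rewrite normc_cpow; case: z.
Qed.

Lemma mellin_realC x t : mellin x%:C t = (real_mellin x t)%:C.
Proof.
rewrite /mellin /real_mellin; case: ifP => // t0.
by rewrite cpowE -[1]/(1%:C) -rmorphB -rmorphM cexp_realC.
Qed.

Lemma mellin_pos z t : 0 < t -> mellin z t = cpow t (z - 1).
Proof. by rewrite /mellin => ->. Qed.

Lemma mellin_npos z t : t <= 0 -> mellin z t = 0.
Proof. by rewrite /mellin leNgt => /negbTE ->. Qed.

(** Valid for every sign of t because both sides vanish when t <= 0. *)
Lemma mellinM z s t : 0 < s -> mellin z (s * t) = mellin z s * mellin z t.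
Proof.
move=> s0; rewrite /mellin s0 pmulr_rgt0//; case: ifP => t0.
  by rewrite cpowM.
by rewrite mulr0.
Qed.

Lemma mellinD z w t : mellin (z + w) t = t%:C * (mellin z t * mellin w t).
Proof.
rewrite /mellin; case: ifP => t0; last by rewrite !mulr0.
have -> : t%:C = cpow t 1 by rewrite -[1]/(1%:C) cpow_realC// powRr1 1?ltW.
by rewrite -!cpowD; congr cpow; ring.
Qed.

Lemma mellin1 t : mellin 1 t = if 0 < t then 1 else 0.
Proof.
rewrite /mellin; case: ifP => // t0.
by rewrite subrr cpowE mul0r cexp_realC expR0.
Qed.

Lemma measurable_cos : measurable_fun [set: R] (@cos R).
Proof. by apply: continuous_measurable_fun; exact: continuous_cos. Qed.

Lemma measurable_sin : measurable_fun [set: R] (@sin R).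
Proof. by apply: continuous_measurable_fun; exact: continuous_sin. Qed.

Lemma cmeasurable_cpow z : cmeasurable [set: R] (fun t => cpow t z).
Proof.
have ml (a : R) : measurable_fun [set: R] (fun t => a * ln t).
  by apply: measurable_funM => //; exact: measurable_ln.
apply: cmeasurableM.
  apply: cmeasurable_realC.
  by apply: (measurableT_comp (@measurable_expR R)).
split.
  exact: (measurableT_comp measurable_cos).
exact: (measurableT_comp measurable_sin).
Qed.

Lemma cmeasurable_mellin z : cmeasurable [set: R] (mellin z).
Proof.
have [mR mI] := cmeasurable_cpow (z - 1).
have mb : measurable_fun [set: R] (fun t : R => 0 < t).
  by apply: measurable_fun_ltr.
split; rewrite /mellin.
  under eq_fun do rewrite (fun_if (@complex.Re R)).
  by apply: measurable_fun_ifT.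
under eq_fun do rewrite (fun_if (@complex.Im R)).
by apply: measurable_fun_ifT.
Qed.

Lemma measurable_real_mellin x : measurable_fun [set: R] (real_mellin x).
Proof.
have [mR _] := cmeasurable_mellin x%:C.
rewrite (_ : real_mellin x = (fun t => complex.Re (mellin x%:C t)))//.
by apply/funext => t; rewrite mellin_realC.
Qed.

End complex_power.

(** * The integral of a power over the unit interval *)

Section ftc_unit_interval.
Context {R : realType}.
Notation mu := (@lebesgue_measure R).
Variables (F f : R -> R).
Hypothesis dF : forall x : R, 0 < x -> is_derive x 1 F (f x).
Hypothesis cf : forall x : R, 0 < x -> {for x, continuous f}.

Let harm (n : nat) : R := n.+1%:R^-1.

Let harm_gt0 n : 0 < harm n. Proof. by rewrite invr_gt0. Qed.

Let I n : set R := `[harm n, 1%R]%classic.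

Let bigcup_I : \bigcup_n I n = `]0%R, 1%R]%classic.
Proof.
apply/seteqP; split => x /=.
  move=> [n _]; rewrite /I /= !in_itv/= => /andP[hx ->].
  by rewrite (lt_le_trans _ hx).
rewrite in_itv/= => /andP[x0 x1].
exists (Num.truncn x^-1) => //=; rewrite /I /= in_itv/= x1 andbT.
by rewrite invf_ple ?posrE// ltW// truncnS_gt.
Qed.

Let FTC n : (\int[mu]_(x in I n) (f x)%:E = (F 1 - F (harm n))%:E)%E.
Proof.
have [->|n0] := posnP n.
  by rewrite /I /harm invr1 subrr set_itv1 integral_set1.
rewrite EFinB; apply: continuous_FTC2.
- by rewrite /harm invf_lt1// ltr1n ltnS.
- apply: continuous_in_subspaceT => x; rewrite inE/= in_itv/= => /andP[hx _].
  by apply: cf; exact: lt_le_trans hx.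
- have cF x : 0 < x -> {for x, continuous F}.
    move=> x0; apply: differentiable_continuous; apply/derivable1_diffP.
    by have [] := dF x0.
  split.
  + move=> x; rewrite in_itv/= => /andP[hx _].
    by have [] := dF (lt_trans (harm_gt0 n) hx).
  + by apply: cvg_at_right_filter; exact: cF.
  + by apply: cvg_at_left_filter; exact: cF.
- move=> x; rewrite in_itv/= => /andP[hx _]; rewrite derive1E.
  by have [_ ->] := dF (lt_trans (harm_gt0 n) hx).
Qed.

Let U : set R := `]0%R, 1%R]%classic.

Let cvgI (g : R -> \bar R) : measurable_fun U g -> (forall x, 0 <= g x)%E ->
  (\int[mu]_(x in I n) g x)%E @[n --> \oo] --> (\int[mu]_(x in U) g x)%E.
Proof.
move=> mg g0; rewrite /U -bigcup_I.
apply: ge0_nondecreasing_set_cvg_integral => //.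
- move=> m n mn; apply/subsetPset => x; rewrite /I /= !in_itv/=.
  move=> /andP[hx ->]; rewrite andbT; apply: le_trans hx.
  by rewrite /harm lef_pV2 ?posrE// ler_nat.
- by move=> i; exact: measurable_itv.
- move=> i; apply: measurable_funS mg; first exact: measurable_itv.
  move=> x; rewrite /I /U /= !in_itv/=.
  by move=> /andP[hx ->]; rewrite (lt_le_trans _ hx).
Qed.

Let mf : measurable_fun U f.
Proof.
apply: (@measurable_funS _ _ _ _ (`]0%R, +oo[%classic : set R)) => //.
  by move=> x; rewrite /U/= !in_itv/= => /andP[->].
apply: open_continuous_measurable_fun; first exact: interval_open.
by move=> x; rewrite inE/= in_itv/= andbT; exact: cf.
Qed.

Let mEf : measurable_fun U (EFin \o f).
Proof. by apply/measurable_EFinP; exact: mf. Qed.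

(** On [1/(n+1), 1] the integral is F 1 - F (1/(n+1)) <= F 1; monotone convergence
passes to the limit although f may be unbounded near 0. *)
Lemma FTC01_ge0_integrable : (forall x, 0 < x -> 0 <= f x) ->
    (forall x, 0 < x -> 0 <= F x) -> mu.-integrable U (EFin \o f).
Proof.
move=> f0 F0; apply/integrableP; split => //.
apply: (@le_lt_trans _ _ (F 1)%:E); last exact: ltry.
have mg : measurable_fun U (abse \o (EFin \o f)) by exact: measurableT_comp.
have cI := cvgI mg (fun x => abse_ge0 _).
rewrite -(cvg_lim _ cI)//; apply: lime_le.
  by apply/cvg_ex; exists (\int[mu]_(x in U) (abse \o (EFin \o f)) x)%E.
apply: nearW => n /=.
rewrite (_ : (\int[mu]_(x in I n) _)%E = (\int[mu]_(x in I n) (f x)%:E)%E).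
  by rewrite FTC lee_fin gerBl F0.
apply: eq_integral => x; rewrite inE /I/= in_itv/= => /andP[hx _].
by rewrite ger0_norm// f0// (lt_le_trans _ hx).
Qed.

Lemma FTC01 : mu.-integrable U (EFin \o f) ->
    F (harm n) @[n --> \oo] --> (0 : R) ->
  Rintegral mu U f = F 1.
Proof.
move=> fi F0.
have mU : measurable (U : set (measurableTypeR R)) by exact: measurable_itv.
have c1 : (\int[mu]_(x in I n) (f x)%:E)%E @[n --> \oo] -->
    (\int[mu]_(x in U) (f x)%:E)%E.
  rewrite integralE; under eq_fun do rewrite integralE.
  apply: cvgeB.
  - exact: (integrable_add_def mU fi).
  - exact: (cvgI (measurable_funepos mEf) (@funepos_ge0 _ _ _)).
  - exact: (cvgI (measurable_funeneg mEf) (@funeneg_ge0 _ _ _)).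
have c2 : (\int[mu]_(x in I n) (f x)%:E)%E @[n --> \oo] --> (F 1)%:E.
  under eq_fun do rewrite FTC.
  apply: cvg_EFin; first exact: nearW.
  rewrite -[X in _ --> X]subr0; apply: cvgB => //; exact: cvg_cst.
by rewrite /Rintegral (cvg_unique _ c1 c2).
Qed.

End ftc_unit_interval.

Section power_integral.
Context {R : realType}.
Notation mu := (@lebesgue_measure R).
Implicit Types (z : R[i]) (t : R).

Lemma is_derive_cpow z t : 0 < t ->
  is_derive t 1 (fun s => complex.Re (cpow s z))
    (complex.Re (z * cpow t (z - 1))) /\
  is_derive t 1 (fun s => complex.Im (cpow s z))
    (complex.Im (z * cpow t (z - 1))).
Proof.
move=> t0; case: z => a b.
have dl (k : R) : is_derive t 1 (fun s => k * ln s) (k * t^-1).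
  exact: (is_deriveZ k (is_derive1_ln t0)).
have de := @is_derive1_comp R expR (fun s => a * ln s) t _ _
  (is_derive_expR _) (dl a).
have dc := @is_derive1_comp R (@cos R) (fun s => b * ln s) t _ _
  (is_derive_cos _) (dl b).
have ds := @is_derive1_comp R (@sin R) (fun s => b * ln s) t _ _
  (is_derive_sin _) (dl b).
have -> : cpow t ((a +i* b) - 1) = (t^-1)%:C * cpow t (a +i* b).
  rewrite cpowD mulrC -[1]/(1%:C) -rmorphN cpow_realC// powRN powRr1//.
  exact: ltW.
rewrite /cpow /= !mul0r !subr0 !addr0.
split.
  under eq_fun do rewrite mul0r subr0.
  apply: (is_derive_eq (is_deriveM de dc)).
  by rewrite /GRing.scale /= ; ring.
under eq_fun do rewrite mul0r addr0.
apply: (is_derive_eq (is_deriveM de ds)).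
by rewrite /GRing.scale /= ; ring.
Qed.

Lemma continuous_cpow z t : 0 < t ->
  {for t, continuous (fun s => complex.Re (cpow s z))} /\
  {for t, continuous (fun s => complex.Im (cpow s z))}.
Proof.
move=> t0; have [dR dI] := is_derive_cpow z t0.
by split; apply: differentiable_continuous; apply/derivable1_diffP;
  [case: dR|case: dI].
Qed.

Lemma continuous_dcpow z t : 0 < t ->
  {for t, continuous (fun s => complex.Re (z * cpow s (z - 1)))} /\
  {for t, continuous (fun s => complex.Im (z * cpow s (z - 1)))}.
Proof.
move=> t0; have [cR cI] := continuous_cpow (z - 1) t0.
have cM (k : R) (g : R -> R) : {for t, continuous g} ->
    {for t, continuous (fun s => k * g s)}.
  by move=> cg; apply: continuousM => //; exact: cst_continuous.
have funR : (fun s => complex.Re (z * cpow s (z - 1))) =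
  (fun s => complex.Re z * complex.Re (cpow s (z - 1)) -
            complex.Im z * complex.Im (cpow s (z - 1))).
  by apply/funext => s; rewrite ReM.
have funI : (fun s => complex.Im (z * cpow s (z - 1))) =
  (fun s => complex.Re z * complex.Im (cpow s (z - 1)) +
            complex.Im z * complex.Re (cpow s (z - 1))).
  by apply/funext => s; rewrite ImM.
split; [rewrite /prop_for funR|rewrite /prop_for funI].
  by apply: cvgB; exact: cM.
by apply: cvgD; exact: cM.
Qed.

Let U : set (measurableTypeR R) := `]0%R, 1%R]%classic.
Let mU : measurable U. Proof. exact: measurable_itv. Qed.

(** The modulus is t^(x-1) with x = Re z, whose primitive t^x / x is nonnegative. *)
Lemma cpow_integrable01 z : 0 < complex.Re z ->
  cintegrable U (fun t => cpow t (z - 1)).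
Proof.
move=> z0; apply: cintegrable_normc => //.
  have [mR mI] := cmeasurable_cpow (z - 1).
  by split; [exact: (measurable_funTS mR)|exact: (measurable_funTS mI)].
pose x := complex.Re z.
have xz t : normc (cpow t (z - 1)) = expR ((x - 1) * ln t).
  by rewrite normc_cpow /x; case: (z) => a b.
rewrite (_ : (fun t => _) = (fun t => expR ((x - 1) * ln t))); last first.
  by apply/funext.
have E t : 0 < t -> x%:C * cpow t (x%:C - 1) = (x * expR ((x - 1) * ln t))%:C.
  move=> t0; rewrite -[1]/(1%:C) -rmorphB cpow_realC// -rmorphM /powR gt_eqF//.
suff I : mu.-integrable U (EFin \o (fun t => x * expR ((x - 1) * ln t))).
  have := integrableZl mU x^-1 I.
  apply: eq_integrable => // t _ /=.
  by rewrite -EFinM mulKf// gt_eqF.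
apply: (@FTC01_ge0_integrable _ (fun t => complex.Re (cpow t x%:C))).
- move=> t t0; have [d _] := is_derive_cpow x%:C t0.
  by apply: is_derive_eq d _; rewrite E.
- move=> t t0; apply: continuousM; first exact: cst_continuous.
  apply: continuous_comp; last exact: continuous_expR.
  by apply: continuousM; [exact: cst_continuous|exact: continuous_ln].
- by move=> t t0; rewrite mulr_ge0 ?expR_ge0 ?ltW.
- by move=> t t0; rewrite cpow_realC//= powR_ge0.
Qed.

Lemma cpow_cvg0 z : 0 < complex.Re z ->
  complex.Re (cpow (n.+1%:R^-1 : R) z) @[n --> \oo] --> (0 : R) /\
  complex.Im (cpow (n.+1%:R^-1 : R) z) @[n --> \oo] --> (0 : R).
Proof.
move=> z0.
have N : normc (cpow (n.+1%:R^-1 : R) z) @[n --> \oo] --> (0 : R).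
  have /cvg_at_rightP H := powR_cvg0 z0.
  rewrite (_ : (fun n => _) = (fun n => (n.+1%:R^-1 : R) `^ complex.Re z)).
    apply: (H (fun n => n.+1%:R^-1)); split; last exact: cvg_harmonic.
    by move=> n; rewrite invr_gt0.
  by apply/funext => n; rewrite normc_cpow /powR gt_eqF.
split; apply: norm_cvg0; apply: (squeeze_cvgr _ (cvg_cst 0) N);
  apply: nearW => n; rewrite normr_ge0; [exact: ler_Re_normc|exact: ler_Im_normc].
Qed.

Lemma cintegral_cpow01 z : 0 < complex.Re z ->
  z * cintegral U (fun t => cpow t (z - 1)) = 1.
Proof.
move=> z0; have ci := cpow_integrable01 z0.
rewrite -cintegralZ// /cintegral.
have [iR iI] := cintegrableZ z mU ci.
have [c0R c0I] := cpow_cvg0 z0.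
rewrite (FTC01 (F := fun t => complex.Re (cpow t z)) _ _ iR c0R); last 2 first.
- by move=> t t0; have [] := is_derive_cpow z t0.
- by move=> t t0; have [] := continuous_dcpow z t0.
rewrite (FTC01 (F := fun t => complex.Im (cpow t z)) _ _ iI c0I); last 2 first.
- by move=> t t0; have [] := is_derive_cpow z t0.
- by move=> t t0; have [] := continuous_dcpow z t0.
by rewrite -complexEta cpowE ln1 mulr0 cexp_realC expR0.
Qed.

End power_integral.

(** * Euler's integral for Gamma *)

Section gamma_kernel.
Context {R : realType}.
Notation mu := (@lebesgue_measure R).
Implicit Types (z : R[i]) (t x : R).

Let mT : measurable [set: measurableTypeR R]. Proof. exact: measurableT. Qed.

Definition gamma_kernel z t : R[i] := mellin z t * (expR (- t))%:C.

Definition gamma_density x t : R := real_mellin x t * expR (- t).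

Lemma gamma_density_ge0 x t : 0 <= gamma_density x t.
Proof. by rewrite mulr_ge0 ?real_mellin_ge0 ?expR_ge0. Qed.

Lemma measurable_gamma_density x : measurable_fun [set: R] (gamma_density x).
Proof.
apply: measurable_funM; first exact: measurable_real_mellin.
apply: (measurableT_comp (@measurable_expR R)).
exact: measurable_funN.
Qed.

Lemma cmeasurable_gamma_kernel z : cmeasurable [set: R] (gamma_kernel z).
Proof.
apply: cmeasurableM; first exact: cmeasurable_mellin.
apply: cmeasurable_realC; apply: (measurableT_comp (@measurable_expR R)).
exact: measurable_funN.
Qed.

Lemma normc_gamma_kernel z t : normc (gamma_kernel z t) = gamma_density (complex.Re z) t.
Proof.
by rewrite /gamma_kernel /gamma_density normcM normc_mellin normc_realC ger0_norm ?expR_ge0.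
Qed.

Lemma gamma_kernel_realC x t : gamma_kernel x%:C t = (gamma_density x t)%:C.
Proof. by rewrite /gamma_kernel /gamma_density mellin_realC -rmorphM. Qed.

(** Powers are dominated by exponentials: ln t <= t / k + ln k, and k is chosen so
large that |x - 1| / k <= 1/2. The factor e^(-t/2) left over is a multiple of an
exponential density. *)
Lemma gamma_density_tail x : exists2 C : R, 0 <= C &
  forall t, 1 < t -> gamma_density x t <= C * exponential_pdf 2^-1 t.
Proof.
pose k := 2 * (`|x - 1| + 1).
have x1 : 0 <= `|x - 1| by [].
have k0 : 0 < k by rewrite /k; lra.
exists (2 * expR (`|x - 1| * ln k)); first by rewrite mulr_ge0 ?expR_ge0.
move=> t t1; have t0 : 0 < t by exact: lt_trans t1.
rewrite exponential_pdfE; last exact: ltW.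
rewrite mulrACA divff// mul1r /gamma_density /real_mellin t0 -!expRD ler_expR.
have lt0 : 0 <= ln t by rewrite ln_ge0// ltW.
have lk : ln t <= t / k + ln k.
  have -> : ln t = ln (t / k) + ln k.
    by rewrite ln_div ?posrE// subrK.
  by rewrite lerD2r ltW// ln_sublinear// divr_gt0.
have h1 : (x - 1) * ln t <= `|x - 1| * (t / k + ln k).
  apply: le_trans (ler_wpM2l x1 lk).
  by rewrite ler_wpM2r// ler_norm.
have h2 : `|x - 1| * (t / k) <= 2^-1 * t.
  rewrite mulrCA mulrC ler_wpM2r//; first exact: ltW.
  rewrite ler_pdivrMr// /k; lra.
move: h1; rewrite mulrDr => h1; rewrite mulNr; lra.
Qed.

Lemma gamma_density_integrable x : 0 < x -> mu.-integrable setT (EFin \o gamma_density x).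
Proof.
move=> x0; have [C C0 tail] := gamma_density_tail x.
pose U : set (measurableTypeR R) := `]0%R, 1%R]%classic.
have mU : measurable U by exact: measurable_itv.
have z0 : 0 < complex.Re x%:C by [].
have iU : mu.-integrable U (EFin \o (fun t => expR ((x - 1) * ln t))).
  have := normc_integrable mU (cpow_integrable01 z0).
  apply: eq_integrable => // t _; congr EFin.
  by rewrite normc_cpow -[1]/(1%:C) -rmorphB.
have iUT := (integrable_mkcond _ mU).1 iU.
have iE : mu.-integrable setT (EFin \o exponential_pdf (2^-1 : R)).
  by apply: integrable_exponential_pdf; rewrite invr_gt0.
apply: (le_integrable mT _ _ (integrableD mT iUT (integrableZl mT C iE))).
  by apply/measurable_EFinP; exact: measurable_gamma_density.
move=> t _; rewrite /= ger0_norm ?gamma_density_ge0// patchE.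
have e0 : 0 <= C * exponential_pdf 2^-1 t.
  by rewrite mulr_ge0// exponential_pdf_ge0// invr_ge0.
case: ifPn => [|/negP]; rewrite inE /U /= in_itv/=.
  move=> /andP[t0 t1].
  rewrite lee_fin ger0_norm ?addr_ge0 ?expR_ge0// /gamma_density /real_mellin t0.
  apply: (@le_trans _ _ (expR ((x - 1) * ln t))); last by rewrite lerDl.
  by rewrite ler_piMr ?expR_ge0// expR_le1// oppr_le0 ltW.
move=> tn; rewrite add0r lee_fin (ger0_norm e0).
have [t0|t0] := leP t 0.
  by rewrite /gamma_density /real_mellin ltNge t0 /= mul0r.
by apply: tail; rewrite ltNge; apply/negP => t1; apply: tn; rewrite t0.
Qed.

Lemma gamma_kernel_cintegrable z : 0 < complex.Re z -> cintegrable setT (gamma_kernel z).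
Proof.
move=> z0; apply: cintegrable_normc => //; first exact: cmeasurable_gamma_kernel.
have := gamma_density_integrable z0; apply: eq_integrable => // t _ /=.
by rewrite normc_gamma_kernel.
Qed.

Lemma Gamma_cintegral z : 0 < complex.Re z ->
  Gamma z = cintegral setT (gamma_kernel z).
Proof.
move=> z0; rewrite /Gamma z0 /euler_integral.
apply: cintegral_extend => t /=; rewrite in_itv/= andbT /gamma_kernel.
  by move=> t0; rewrite mellin_pos.
by move=> /negP; rewrite -leNgt => t0; rewrite mellin_npos// mul0r.
Qed.

Definition real_Gamma x : R := Rintegral mu setT (gamma_density x).

Lemma Gamma_realC x : 0 < x -> Gamma x%:C = (real_Gamma x)%:C.
Proof.
move=> x0; rewrite Gamma_cintegral// -cintegral_realC.
by apply: eq_cintegral => t _; rewrite gamma_kernel_realC.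
Qed.

(** On [1, 2] the integrand is at least the constant c below. *)
Lemma real_Gamma_gt0 x : 0 < x -> 0 < real_Gamma x.
Proof.
move=> x0; have fi := gamma_density_integrable x0.
pose c := expR (- (`|x - 1| * ln 2) - 2).
pose V : set (measurableTypeR R) := `[1%R, 2%R]%classic.
have mV : measurable V by exact: measurable_itv.
have muV : mu V = 1%E.
  by rewrite lebesgue_measure_itv/= lte_fin ltr1n -EFinB; congr (_%:E); lra.
apply: (@lt_le_trans _ _ c); first exact: expR_gt0.
have <- : Rintegral mu V (fun=> c) = c.
  transitivity (c * fine (mu V)); last by rewrite muV mulr1.
  exact: Rintegral_cst.
rewrite Rintegral_mkcond; apply: le_Rintegral => //.
- rewrite -restrict_EFin; apply/(integrable_mkcond _ mV).1.
  apply: continuous_compact_integrable; first exact: segment_compact.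
  by apply: continuous_subspaceT => t; exact: cst_continuous.
- move=> t _; rewrite patchE; case: ifPn => [|_]; last exact: gamma_density_ge0.
  rewrite inE /V/= in_itv/= => /andP[t1 t2].
  have t0 : 0 < t by lra.
  rewrite /gamma_density /real_mellin t0 -expRD ler_expR lerD// ?lerN2//.
  rewrite lerNl -mulNr.
  have lt0 : 0 <= ln t by rewrite ln_ge0.
  have lt2 : ln t <= ln 2 by rewrite ler_ln ?posrE.
  apply: (@le_trans _ _ (`|x - 1| * ln t)).
    by rewrite ler_wpM2r// -normrN ler_norm.
  by rewrite ler_wpM2l.
Qed.

End gamma_kernel.

(** * Euler's Beta integral *)

Section beta.
Context {R : realType}.
Notation mu := (@lebesgue_measure R).
Implicit Types (p q : R[i]) (s u t x : R).

Let mT : measurable [set: measurableTypeR R]. Proof. exact: measurableT. Qed.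

Definition beta_kernel p q s : R[i] := mellin p s * mellin q (1 - s).

Definition Beta p q : R[i] := cintegral setT (beta_kernel p q).

Lemma cmeasurable_beta_kernel p q : cmeasurable [set: R] (beta_kernel p q).
Proof.
apply: cmeasurableM; first exact: cmeasurable_mellin.
apply: (cmeasurable_comp (cmeasurable_mellin q)).
by apply: measurable_funB => //; exact: measurable_cst.
Qed.

(** The integrand s^(p-1) (u - s)^(q-1) e^(-u) at the point (s, u); [H1] and [H2]
factor it by the translation u = s + t and by the dilation s = u xi. *)
Let H p q (z : R * R) : R[i] :=
  mellin p z.1 * mellin q (z.2 - z.1) * (expR (- z.2))%:C.

Let mH p q : cmeasurable [set: R * R] (H p q).
Proof.
apply: cmeasurableM.
  apply: cmeasurableM.
    exact: (cmeasurable_comp (cmeasurable_mellin p) measurable_fst).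
  apply: (cmeasurable_comp (cmeasurable_mellin q)).
  by apply: measurable_funB; [exact: measurable_snd|exact: measurable_fst].
apply: cmeasurable_realC; apply: (measurableT_comp (@measurable_expR R)).
by apply: measurable_funN; exact: measurable_snd.
Qed.

Let H1 p q s u : H p q (s, u) = gamma_kernel p s * gamma_kernel q (1 * u + - s).
Proof.
rewrite /H /gamma_kernel /= mul1r.
have -> : (expR (- u))%:C = (expR (- s))%:C * (expR (- (u - s)))%:C :> R[i].
  by rewrite -rmorphM -expRD; congr ((expR _)%:C); lra.
by ring.
Qed.

Let H2 p q s u : 0 < u -> H p q (s, u) =
  (mellin p u * mellin q u * (expR (- u))%:C) * beta_kernel p q (u^-1 * s + 0).
Proof.
move=> u0; rewrite /H /beta_kernel /= addr0.
have -> : mellin p s = mellin p u * mellin p (u^-1 * s).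
  by rewrite -mellinM// mulVKf// gt_eqF.
have -> : mellin q (u - s) = mellin q u * mellin q (1 - u^-1 * s).
  by rewrite -mellinM// mulrBr mulr1 mulVKf// gt_eqF.
by ring.
Qed.

Let H20 p q s u : u <= 0 -> H p q (s, u) = 0.
Proof.
move=> u0; rewrite /H /=; have [s0|s0] := leP s 0.
  by rewrite mellin_npos// !mul0r.
by rewrite (@mellin_npos _ q) ?mulr0 ?mul0r//; lra.
Qed.

Section positive_real_parts.
Variables p q : R[i].
Hypotheses (p0 : 0 < complex.Re p) (q0 : 0 < complex.Re q).

Let N (f : R -> R[i]) : \bar R := (\int[mu]_x (normc (f x))%:E)%E.

Let N_ge0 f : (0 <= N f)%E.
Proof. by apply: integral_ge0 => x _; rewrite lee_fin normc_ge0. Qed.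

Let N_fin f : cintegrable setT f -> N f \is a fin_num.
Proof.
by move=> fi; apply: integrable_fin_num => //; exact: normc_integrable.
Qed.

Let NZ c f : cmeasurable [set: R] f -> N (fun x => c * f x) = ((normc c)%:E * N f)%E.
Proof.
move=> mf; rewrite /N; under eq_integral do rewrite normcM EFinM.
apply: ge0_integralZl_EFin => //; last exact: normc_ge0.
- by move=> x _; rewrite lee_fin normc_ge0.
- by apply/measurable_EFinP; exact: cmeasurable_normc.
Qed.

Let Naffine (a b : R) f : 0 < a -> cmeasurable [set: R] f ->
  N f = (a%:E * N (fun x => f (a * x + b)%R))%E.
Proof.
move=> a0 mf; rewrite /N; apply: (@ge0_integral_affine _ _ _ a0 (fun x => (normc (f x))%:E)).
- by apply/measurable_EFinP; exact: cmeasurable_normc.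
- by move=> x; rewrite lee_fin normc_ge0.
Qed.

Let H_integrable : (mu \x mu)%E.-integrable setT (EFin \o (fun z => normc (H p q z))).
Proof.
apply/integrable12ltyP.
  by apply/measurable_EFinP; exact: cmeasurable_normc (mH p q).
have fp := N_fin (gamma_kernel_cintegrable p0).
have fq := N_fin (gamma_kernel_cintegrable q0).
rewrite [ltLHS](_ : _ = N (fun s => (fine (N (gamma_kernel q)))%:C * gamma_kernel p s)).
  rewrite NZ; last exact: cmeasurable_gamma_kernel.
  by rewrite lte_mul_pinfty ?lee_fin ?normc_ge0// -ge0_fin_numE.
apply: eq_integral => s _.
rewrite normcM normc_realC ger0_norm ?fine_ge0// EFinM fineK//.
rewrite (@Naffine 1 (- s) (gamma_kernel q))//; last exact: cmeasurable_gamma_kernel.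
rewrite mul1e muleC -NZ; last first.
  apply: (cmeasurable_comp (cmeasurable_gamma_kernel q)).
  apply: measurable_affine.
apply: eq_integral => u _.
by rewrite -H1 gee0_abs// lee_fin normc_ge0.
Qed.

(** By Tonelli the double integral of |H| is finite and equals the product of the
integrals of two moduli, that of the kernel of Gamma (p + q) and that of the Beta
kernel. The first is positive, hence the second is finite. *)
Lemma beta_kernel_cintegrable : cintegrable setT (beta_kernel p q).
Proof.
have mb := cmeasurable_beta_kernel p q.
apply: cintegrable_normc => //; apply/integrableP; split.
  by apply/measurable_EFinP; exact: cmeasurable_normc.
under eq_integral do rewrite /= ger0_norm ?normc_ge0//.
rewrite -/(N _).
have : (\int[mu]_u \int[mu]_s `|(EFin \o (fun z => normc (H p q z))) (s, u)|
    < +oo)%E.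
  apply/integrable21ltyP; last exact: H_integrable.
  by apply/measurable_EFinP; exact: cmeasurable_normc (mH p q).
rewrite [ltLHS](_ : _ = (N (gamma_kernel (p + q)%R) * N (beta_kernel p q))%E).
  have pq0 : 0 < complex.Re (p + q).
    by move: p0 q0; case: (p) => a b; case: (q) => c d /=; exact: addr_gt0.
  have fg : N (gamma_kernel (p + q)) = (real_Gamma (complex.Re (p + q)))%:E.
    rewrite /real_Gamma /Rintegral fineK; last first.
      by apply: integrable_fin_num => //; exact: gamma_density_integrable.
    by apply: eq_integral => t _; rewrite normc_gamma_kernel.
  have G0 := real_Gamma_gt0 pq0.
  have := N_ge0 (beta_kernel p q); rewrite fg; case: (N _) => [r||]//= _.
    by move=> _; exact: ltry.
  by rewrite gt0_muley// lte_fin.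
rewrite /N -ge0_integralZr//; last 3 first.
- by apply/measurable_EFinP; exact: cmeasurable_normc (cmeasurable_gamma_kernel _).
- by move=> x _; rewrite lee_fin normc_ge0.
- exact: N_ge0.
apply: eq_integral => u _.
have [u0|u0] := leP u 0.
  rewrite /gamma_kernel mellin_npos// mul0r normc0 mul0e.
  by apply: integral0_eq => s _; rewrite /= H20// normc0 normr0.
transitivity (N (fun s =>
    (mellin p u * mellin q u * (expR (- u))%:C) * beta_kernel p q (u^-1 * s + 0)%R)).
  by apply: eq_integral => s _; rewrite /= ger0_norm ?normc_ge0// H2.
rewrite NZ; last first.
  by apply: (cmeasurable_comp mb); exact: measurable_affine.
have iu : 0 < u^-1 by rewrite invr_gt0.
rewrite -/(N (beta_kernel p q)) (@Naffine u^-1 0 (beta_kernel p q))// muleA.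
congr (_ * _)%E; rewrite -EFinM; congr EFin.
rewrite /gamma_kernel mellinD !normcM !normc_realC (gtr0_norm u0).
by field; rewrite gt_eqF.
Qed.

Lemma Gamma_mul_cintegral :
  cintegral setT (gamma_kernel p) * cintegral setT (gamma_kernel q) =
  Beta p q * cintegral setT (gamma_kernel (p + q)).
Proof.
have pq0 : 0 < complex.Re (p + q).
  by move: p0 q0; case: (p) => a b; case: (q) => c d /=; exact: addr_gt0.
have ip := gamma_kernel_cintegrable p0; have iq := gamma_kernel_cintegrable q0.
have ipq := gamma_kernel_cintegrable pq0.
have := @cintegral_Fubini _ (H p q) (mH p q) _ _ H_integrable.
have i1 s : cintegrable setT (fun u => H p q (s, u)).
  rewrite (_ : (fun u => _) = (fun u => gamma_kernel p s * gamma_kernel q (1 * u + - s))).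
    by apply: cintegrableZ => //; exact: cintegrable_affine.
  by apply/funext => u; rewrite H1.
have i2 u : cintegrable setT (fun s => H p q (s, u)).
  have [u0|u0] := leP u 0.
    rewrite (_ : (fun s => _) = (fun=> 0)).
      by split => /=; exact: integrable0.
    by apply/funext => s; rewrite H20.
  rewrite (_ : (fun s => _) = (fun s =>
    (mellin p u * mellin q u * (expR (- u))%:C) * beta_kernel p q (u^-1 * s + 0))).
    apply: cintegrableZ => //; apply: cintegrable_affine; first by rewrite invr_gt0.
    exact: beta_kernel_cintegrable.
  by apply/funext => s; rewrite H2.
move=> /(_ i1 i2).
have -> : cintegral setT (fun s => cintegral setT (fun u => H p q (s, u))) =
    cintegral setT (gamma_kernel p) * cintegral setT (gamma_kernel q).
  rewrite [RHS]mulrC -cintegralZ//; apply: eq_cintegral => s _.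
  rewrite (@cintegral_affine _ 1 (- s) (gamma_kernel q))// mul1r mulrC -cintegralZ//.
    by apply: eq_cintegral => u _; rewrite H1.
  exact: cintegrable_affine.
move=> ->; rewrite -cintegralZ//; apply: eq_cintegral => u _.
have [u0|u0] := leP u 0.
  rewrite /gamma_kernel mellin_npos// mul0r mulr0 (@eq_cintegral _ _ _ (fun=> 0)).
    by rewrite cintegral_realC /Rintegral integral0.
  by move=> s _; rewrite H20.
have iu : 0 < u^-1 by rewrite invr_gt0.
rewrite /Beta (@cintegral_affine _ u^-1 0 (beta_kernel p q))//; last first.
  exact: beta_kernel_cintegrable.
transitivity ((mellin p u * mellin q u * (expR (- u))%:C) *
    cintegral setT (fun s => beta_kernel p q (u^-1 * s + 0))).
  rewrite -cintegralZ//; last exact: cintegrable_affine iu beta_kernel_cintegrable.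
  by apply: eq_cintegral => s _; rewrite H2.
rewrite /gamma_kernel mellinD fmorphV.
have uC : u%:C != 0 :> R[i] by rewrite eq_complex /= eqxx andbT gt_eqF.
by field.
Qed.

Lemma Gamma_Beta : Gamma p * Gamma q = Beta p q * Gamma (p + q).
Proof.
have pq0 : 0 < complex.Re (p + q).
  by move: p0 q0; case: (p) => a b; case: (q) => c d /=; exact: addr_gt0.
by rewrite !Gamma_cintegral// Gamma_mul_cintegral.
Qed.

End positive_real_parts.

End beta.

(** * Functional equation and lower bound for Gamma *)

Section gamma_bounds.
Context {R : realType}.
Notation mu := (@lebesgue_measure R).
Implicit Types (z : R[i]) (a t u v x y : R).

Let mT : measurable [set: measurableTypeR R]. Proof. exact: measurableT. Qed.

Lemma real_Gamma1 : real_Gamma (1 : R) = 1.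
Proof.
rewrite /real_Gamma.
have E (t : R) : t != 0 -> gamma_density 1 t = exponential_pdf 1 t.
  move=> tn0; rewrite /gamma_density /real_mellin subrr mul0r expR0.
  have [t0|t0] := ltP 0 t.
    by rewrite exponential_pdfE ?ltW// !mul1r mulN1r.
  rewrite mul0r /exponential_pdf patchE ifF//.
  apply/negbTE/negP; rewrite inE/= in_itv/= andbT => t0'.
  by move/eqP: tn0; apply; apply/eqP; rewrite eq_le t0 t0'.
have := @integral_exponential_pdf R 1 ltr01.
rewrite /Rintegral => I1; rewrite (_ : (\int[mu]_t (gamma_density 1 t)%:E)%E = 1%E)//.
rewrite -I1; apply: ae_eq_integral => //.
- by apply/measurable_EFinP; exact: measurable_gamma_density.
- by apply/measurable_EFinP; exact: measurable_exponential_pdf.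
exists [set 0]; split => //; first exact: lebesgue_measure_set1.
move=> t /= nE; apply: contrapT => /eqP t0; apply: nE => _.
by rewrite E.
Qed.

(** For q = 1 the Beta kernel is t^(z-1) on ]0, 1[. *)
Lemma Beta1 z : 0 < complex.Re z -> z * Beta z 1 = 1.
Proof.
move=> z0; rewrite -[RHS](cintegral_cpow01 z0); congr (_ * _).
pose D : set (measurableTypeR R) := `]0%R, 1%R[%classic.
have mD : measurable D by exact: measurable_itv.
have -> : Beta z 1 = cintegral D (fun t => cpow t (z - 1)).
  symmetry; apply: cintegral_extend => t; rewrite /D/= in_itv/= /beta_kernel mellin1.
    by move=> /andP[t0 t1]; rewrite subr_gt0 t1 mulr1 mellin_pos.
  rewrite subr_gt0; case: ifP => t1; last by rewrite mulr0.
  rewrite andbT => /negP; rewrite -leNgt => t0.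
  by rewrite mellin_npos// mul0r.
have [iR iI] := cpow_integrable01 z0.
have DU : D `<=` `]0%R, 1%R].
  by move=> t; rewrite /D/= !in_itv/= => /andP[-> /ltW].
have mU : measurable (`]0%R, 1%R]%classic : set (measurableTypeR R)).
  exact: measurable_itv.
rewrite /cintegral /D; congr (_ +i* _); apply: Rintegral_itv_bndo_bndc.
  exact: (integrableS mU mD DU iR).
exact: (integrableS mU mD DU iI).
Qed.

Lemma GammaS z : 0 < complex.Re z -> Gamma (z + 1) = z * Gamma z.
Proof.
move=> z0; have := @Gamma_Beta _ z 1 z0 ltr01.
rewrite -[X in _ * Gamma X]/((1 : R)%:C) Gamma_realC// real_Gamma1 mulr1 => ->.
by rewrite mulrA Beta1// mul1r.
Qed.

Lemma real_GammaS x : 0 < x -> real_Gamma (x + 1) = x * real_Gamma x.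
Proof.
move=> x0; have x10 : 0 < x + 1 by rewrite addr_gt0.
have := @GammaS x%:C x0; rewrite -[1]/((1 : R)%:C) -rmorphD /=.
by rewrite !Gamma_realC// -rmorphM => /complexI.
Qed.

Lemma normc_Gamma_le z : 0 < complex.Re z ->
  normc (Gamma z) <= 2 * real_Gamma (complex.Re z).
Proof.
move=> z0; rewrite Gamma_cintegral//.
apply: le_trans (normc_cintegral_le _ (gamma_kernel_cintegrable z0)) _ => //.
by under eq_Rintegral do rewrite normc_gamma_kernel.
Qed.

Lemma abs_sin_le x : `|sin x| <= `|x|.
Proof.
wlog x0 : x / 0 <= x.
  move=> wl; have [/wl//|x0] := leP 0 x.
  by have := wl (- x); rewrite sinN !normrN; apply; lra.
move: x0; rewrite le_eqVlt => /predU1P[<-|x0]; first by rewrite sin0.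
have [] := @MVT R (@sin R) (@cos R) 0 x x0 (fun t _ => is_derive_sin t).
  by apply: continuous_subspaceT => t; exact: continuous_sin.
move=> c _; rewrite sin0 !subr0 => ->.
by rewrite normrM ler_piMl// ler_norml cos_geN1 cos_le1.
Qed.

Lemma cos_ge_quad x : 1 - x ^+ 2 / 2 <= cos x.
Proof.
have -> : x = x / 2 + x / 2 by lra.
rewrite cosD -!expr2 cos2sin2.
have := abs_sin_le (x / 2); rewrite -ler_sqr ?nnegrE// !real_normK ?num_real//.
lra.
Qed.

(** The right-hand side is 4 (e^(v/2) - e^(-v/2))^2, and e^h - e^(-h) >= h for
h >= 0. With v = ln u it bounds (ln u)^2 by 4 (u - 2 + 1/u), whose mean under a
Gamma density is explicit. *)
Lemma sqr_le_cosh v : v ^+ 2 <= 4 * (expR v - 2 + expR (- v)).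
Proof.
wlog v0 : v / 0 <= v.
  move=> wl; have [/wl//|v0] := leP 0 v.
  by have := wl (- v); rewrite sqrrN opprK; lra.
pose h := v / 2.
have -> : expR v - 2 + expR (- v) = (expR h - expR (- h)) ^+ 2.
  have -> : v = h + h by rewrite /h; lra.
  have e : expR h * expR (- h) = 1 by rewrite -expRD subrr expR0.
  have e2 : expR (- (h + h)) = expR (- h) * expR (- h) by rewrite opprD expRD.
  by rewrite e2 expRD sqrrB e mulr2n !expr2; lra.
have h0 : 0 <= h by rewrite /h; lra.
have h1 : h <= expR h - expR (- h).
  have := expR_ge1Dx h; have : expR (- h) <= 1 by rewrite expR_le1; lra.
  lra.
have : h ^+ 2 <= (expR h - expR (- h)) ^+ 2.
  by rewrite ler_sqr ?nnegrE// (le_trans h0).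
rewrite {1}/h; lra.
Qed.

Lemma gamma_densityS a t : gamma_density (a + 1) t = t * gamma_density a t.
Proof.
rewrite /gamma_density /real_mellin; case: ifP => t0; last by rewrite !mul0r mulr0.
have -> : (a + 1 - 1) * ln t = (a - 1) * ln t + ln t by lra.
by rewrite expRD lnK ?posrE//; lra.
Qed.

(** After multiplication by the unimodular number a^(-iy), the real part of Euler's
integral is the integral of t^(a-1) e^(-t) cos (y (ln t - ln a)). The cosine is at
least 1 - 2 y^2 (t/a - 2 + a/t), and the functional equation evaluates the integral
of this lower bound: the mean of t/a is 1 and that of a/t is a / (a - 1). *)
Lemma normc_Gamma_ge_large a y : 1 < a ->
  real_Gamma a * (1 - 2 * y ^+ 2 / (a - 1)) <= normc (Gamma (a +i* y)).
Proof.
move=> a1; have a0 : 0 < a by lra. have am0 : 0 < a - 1 by lra.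
have as0 : 0 < a + 1 by lra.
have z0 : 0 < complex.Re (a +i* y) by [].
pose rot : R[i] := cexp (0 +i* (- (y * ln a))).
have nrot : normc rot = 1 by rewrite normc_cexp expR0.
have fi := gamma_kernel_cintegrable z0.
have -> : normc (Gamma (a +i* y)) =
    normc (cintegral setT (fun t => rot * gamma_kernel (a +i* y) t)).
  by rewrite cintegralZ// normcM nrot mul1r Gamma_cintegral.
have [iR _] := cintegrableZ rot mT fi.
apply: le_trans (le_trans (ler_norm _) (ler_Re_normc _)).
rewrite /cintegral /=.
have ReE t : 0 < t -> complex.Re (rot * gamma_kernel (a +i* y) t) =
    gamma_density a t * cos (y * (ln t - ln a)).
  move=> t0; rewrite /rot /gamma_kernel /gamma_density /real_mellin mellin_pos// t0 cpowE.
  have -> : cexp (0 +i* - (y * ln a)) *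
     (cexp (((a +i* y) - 1) * (ln t)%:C) * (expR (- t))%:C) =
     (expR (- t))%:C * cexp (((a - 1) * ln t) +i* (y * (ln t - ln a))).
    rewrite mulrA mulrC -cexpD; congr (_ * cexp _).
    by apply/eqP; rewrite eq_complex /=; apply/andP; split; apply/eqP; ring.
  by rewrite ReM /cexp ReM /= ; ring.
have pw t : gamma_density a t - 2 * y ^+ 2 *
    (a^-1 * gamma_density (a + 1) t - 2 * gamma_density a t + a * gamma_density (a - 1) t) <=
    complex.Re (rot * gamma_kernel (a +i* y) t).
  have [t0|t0] := leP t 0.
    have k0 x : gamma_density x t = 0 by rewrite /gamma_density /real_mellin ltNge t0 mul0r.
    by rewrite !k0 /gamma_kernel mellin_npos// mul0r mulr0 /= !mulr0 subr0 addr0 mulr0 subr0.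
  rewrite ReE//.
  have tn0 : t != 0 by rewrite gt_eqF.
  have an0 : a != 0 by rewrite gt_eqF.
  have e1 : expR (ln t - ln a) = t / a by rewrite expRB !lnK ?posrE.
  have e2 : expR (- (ln t - ln a)) = a / t by rewrite opprB expRB !lnK ?posrE.
  have km : gamma_density (a - 1) t = gamma_density a t / t.
    by have := gamma_densityS (a - 1) t; rewrite subrK => ->; rewrite mulrAC divff// mul1r.
  have := sqr_le_cosh (ln t - ln a); rewrite e1 e2.
  have := cos_ge_quad (y * (ln t - ln a)); rewrite exprMn.
  move: (gamma_density_ge0 a t); rewrite gamma_densityS km.
  set k := gamma_density a t; set c := cos _; set v := (ln t - ln a) ^+ 2 => k0 hc hv.
  have hy : 0 <= y ^+ 2 by exact: sqr_ge0.
  have hyv : y ^+ 2 * v <= y ^+ 2 * (4 * (t / a - 2 + a / t)).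
    by rewrite ler_wpM2l.
  have hk : 1 - 2 * y ^+ 2 * (t / a - 2 + a / t) <= c by lra.
  have := ler_wpM2l k0 hk; apply: le_trans; rewrite le_eqVlt; apply/orP; left.
  by apply/eqP; field; rewrite tn0 an0.
have [ia ia1 iam] : [/\ mu.-integrable setT (EFin \o gamma_density a),
    mu.-integrable setT (EFin \o gamma_density (a + 1)) &
    mu.-integrable setT (EFin \o gamma_density (a - 1))].
  by split; exact: gamma_density_integrable.
pose c := 2 * y ^+ 2.
pose L t := (1 + 2 * c) * gamma_density a t -
   ((c / a) * gamma_density (a + 1) t + (c * a) * gamma_density (a - 1) t).
have iL1 := integrableZl mT (1 + 2 * c) ia.
have iL2 := integrableZl mT (c / a) ia1.
have iL3 := integrableZl mT (c * a) iam.
have iL23 := integrableD mT iL2 iL3.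
have iL : mu.-integrable setT (EFin \o L) := integrableB mT iL1 iL23.
apply: (@le_trans _ _ (Rintegral mu setT L)); last first.
  apply: le_Rintegral => // t _; apply: le_trans (pw t).
  by rewrite /L /c; lra.
rewrite /L (RintegralB mT iL1 iL23) (RintegralD mT iL2 iL3) !RintegralZl//.
rewrite -!/(real_Gamma _) real_GammaS//.
have -> : real_Gamma a = (a - 1) * real_Gamma (a - 1).
  by have := real_GammaS am0; rewrite subrK.
rewrite le_eqVlt; apply/orP; left; apply/eqP; rewrite /c; field.
by rewrite !gt_eqF.
Qed.

(** The bound with c = 1/2 holds once a >= 2 + 4 y^2. Each use of
Gamma (z + 1) = z Gamma z lowers this threshold by one, at the cost of a factor
a / |a + iy|, which is at least x0 / (x0 + |y|). *)
Lemma normc_Gamma_ge x0 y : 0 < x0 -> exists2 c : R, 0 < c &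
  forall a, x0 <= a -> c * real_Gamma a <= normc (Gamma (a +i* y)).
Proof.
move=> x0_gt0; pose A := 2 + 4 * y ^+ 2.
have y2 : 0 <= y ^+ 2 by exact: sqr_ge0.
have Q n : exists2 c : R, 0 < c & forall a, x0 <= a -> A <= a + n%:R ->
    c * real_Gamma a <= normc (Gamma (a +i* y)).
  elim: n => [|n [c c0 IH]].
    exists 2^-1; first by rewrite invr_gt0.
    move=> a xa; rewrite addr0 /A => Aa.
    have a1 : 1 < a by lra.
    apply: le_trans (normc_Gamma_ge_large y a1).
    rewrite [leLHS]mulrC; apply: ler_wpM2l.
      by apply/ltW/real_Gamma_gt0; lra.
    have : 2 * y ^+ 2 / (a - 1) <= 2^-1.
      by rewrite ler_pdivrMr; lra.
    lra.
  exists (c * (x0 / (x0 + `|y|))).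
    by rewrite mulr_gt0// divr_gt0// ltr_pwDl.
  move=> a xa; rewrite -natr1 addrA addrAC => Aa.
  have a0 : 0 < a by lra.
  have xa1 : x0 <= a + 1 by lra.
  have := IH _ xa1 Aa; rewrite real_GammaS//.
  have -> : ((a + 1) +i* y) = (a +i* y) + 1.
    by apply/eqP; rewrite eq_complex /= addr0 !eqxx.
  rewrite GammaS// normcM.
  have nz : normc (a +i* y) <= a + `|y|.
    by rewrite (le_trans (normc_ler_ReIm _))//= (gtr0_norm a0).
  have G0 := normc_ge0 (Gamma (a +i* y)).
  move=> h; have {}h := le_trans h (ler_wpM2r G0 nz).
  have ay : 0 < a + `|y| by rewrite ltr_pwDl.
  have xy : 0 < x0 + `|y| by rewrite ltr_pwDl.
  have g0 : 0 < real_Gamma a by exact: real_Gamma_gt0.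
  apply: (@le_trans _ _ (c * (a / (a + `|y|)) * real_Gamma a)).
    apply: ler_wpM2r; first exact: ltW.
    apply: ler_wpM2l; first exact: ltW.
    rewrite ler_pdivrMr// mulrAC ler_pdivlMr//.
    have := ler_wpM2r (normr_ge0 y) xa; lra.
  rewrite -ler_pdivrMl// in h.
  apply: le_trans h; rewrite le_eqVlt; apply/orP; left.
  by apply/eqP; field; rewrite gt_eqF.
have [c c0 H] := Q (Num.truncn A).+1.
exists c => // a xa; apply: H => //.
have := truncnS_gt A; lra.
Qed.

Lemma Gamma_neq0 z : 0 < complex.Re z -> Gamma z != 0.
Proof.
move=> z0; have [c c0 /(_ _ (lexx _))] := normc_Gamma_ge (complex.Im z) z0.
rewrite -complexEta => h; apply/eqP => E; move: h; rewrite E normc0.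
by rewrite leNgt mulr_gt0// real_Gamma_gt0.
Qed.

End gamma_bounds.

(** * The integral representation *)

(** The modulus of the Beta kernel at (p, q) is the Beta kernel at (Re p, Re q). *)
Lemma integral_normc_beta_kernel (R : realType) (p q : R[i]) :
    0 < complex.Re p -> 0 < complex.Re q ->
  (\int[@lebesgue_measure R]_t (normc (beta_kernel p q t))%:E =
   (real_Gamma (complex.Re p) * real_Gamma (complex.Re q) /
    real_Gamma (complex.Re p + complex.Re q))%:E)%E.
Proof.
move=> p0 q0.
have pq0 : 0 < complex.Re p + complex.Re q by exact: addr_gt0.
have ib := normc_integrable measurableT (beta_kernel_cintegrable p0 q0).
have E : Beta (complex.Re p)%:C (complex.Re q)%:C =
    (Rintegral (@lebesgue_measure R) setT (fun t => normc (beta_kernel p q t)))%:C.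
  rewrite -cintegral_realC; apply: eq_cintegral => t _.
  by rewrite /beta_kernel normcM !mellin_realC !normc_mellin -rmorphM.
have := @Gamma_Beta _ (complex.Re p)%:C (complex.Re q)%:C p0 q0.
rewrite E -rmorphD /= !Gamma_realC// -!rmorphM => /complexI ->.
rewrite mulfK ?gt_eqF ?real_Gamma_gt0// /Rintegral fineK//.
exact: integrable_fin_num.
Qed.

(** Away from the poles the limit reading of the quotient does not intervene. *)
Lemma pochhammer_Re_gt0 (R : realType) (g : R[i]) (l : R) :
  0 < complex.Re g -> pochhammer g l = Gamma (g + l%:C) / Gamma g.
Proof.
move=> g0; rewrite /pochhammer ifF//; apply/negbTE/negP => /andP[/asboolP[k gk] _].
move: g0; rewrite gk; apply/negP; rewrite -leNgt.
by rewrite -(rmorph_nat (real_complex R)) -rmorphN /= oppr_le0.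
Qed.

(** Taking the modulus inside the Beta integral costs at most a constant factor,
uniformly in s: this is what makes absolute convergence of the double series
sufficient for the termwise integration. *)
Lemma beta_abs_le (R : realType) (p q : R[i]) :
    0 < complex.Re p -> 0 < complex.Re q ->
  exists2 K : R, 0 <= K & forall s, 0 <= s ->
   (\int[@lebesgue_measure R]_t (normc (beta_kernel (p + s%:C) q t))%:E <=
    (K * normc (Gamma (p + s%:C) / Gamma (p + q + s%:C)))%:E)%E.
Proof.
move=> p0 q0; have [c c0 cG] := normc_Gamma_ge (complex.Im p) p0.
have Gq := real_Gamma_gt0 q0.
exists (2 * real_Gamma (complex.Re q) / c).
  by rewrite divr_ge0 ?mulr_ge0// ltW.
move=> s s0.
have ps0 : 0 < complex.Re (p + s%:C) by rewrite ReD /= ltr_pwDl.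
have pqs0 : 0 < complex.Re (p + q + s%:C) by rewrite !ReD /= ltr_pwDl// addr_gt0.
rewrite integral_normc_beta_kernel// lee_fin normcM normcV.
rewrite -ReD (_ : p + s%:C + q = p + q + s%:C); last by ring.
have h1 : c * real_Gamma (complex.Re (p + s%:C)) <= normc (Gamma (p + s%:C)).
  have -> : Gamma (p + s%:C) = Gamma (complex.Re (p + s%:C) +i* complex.Im p).
    congr Gamma; case: (p) => a b.
    by apply/eqP; rewrite eq_complex /= addr0 !eqxx.
  by apply: cG; rewrite ReD /= lerDl.
have h2 := normc_Gamma_le pqs0.
have N0 : 0 < normc (Gamma (p + q + s%:C)).
  rewrite lt_neqAle normc_ge0 andbT eq_sym; apply/eqP => /eq0_normc E.
  by move: (Gamma_neq0 pqs0); rewrite E eqxx.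
have g1 := real_Gamma_gt0 ps0; have g2 := real_Gamma_gt0 pqs0.
move: Gq h1 h2 N0 g1 g2.
move: (real_Gamma (complex.Re (p + s%:C))) (real_Gamma (complex.Re (p + q + s%:C))).
move: (normc (Gamma (p + s%:C))) (normc (Gamma (p + q + s%:C))).
move: (real_Gamma (complex.Re q)) => G X Y A B G0 h1 h2 Y0 A0 B0.
have i1 : A <= X / c by rewrite ler_pdivlMr// mulrC.
have i2 : B^-1 <= 2 / Y by rewrite ler_pdivlMr// mulrC ler_pdivrMr.
apply: (@le_trans _ _ ((X / c) * G * (2 / Y))).
  apply: ler_pM => //.
  - by rewrite mulr_ge0// ltW.
  - by rewrite invr_ge0 ltW.
  - by apply: ler_wpM2r => //; exact: ltW.
by rewrite le_eqVlt; apply/orP; left; apply/eqP; field; rewrite !gt_eqF.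
Qed.

Lemma ML_termZ (R : realType) (g : R[i]) (a : R) (d : R[i]) (b : R) (z : R[i])
    (t l : R) (m : nat) : 0 < t ->
  ML_term g a d b (z * (t `^ l)%:C) m =
  ML_term g a d b z m * (t `^ (l * m%:R))%:C.
Proof.
move=> t0; rewrite /ML_term exprMn -rmorphXn /=.
have -> : (t `^ l) ^+ m = t `^ (l * m%:R).
  by rewrite powRrM powR_mulrn ?powR_ge0.
by ring.
Qed.

Theorem mainTheorem8 (R : realType)
    (gamma1 gamma2 gamma3 delta1 delta2 delta3 x y : R[i])
    (alpha1 alpha2 alpha4 beta1 beta2 beta4 : R)
    (hgamma1 : 0 < complex.Re gamma1)
    (hdelta1 : complex.Re gamma1 < complex.Re delta1)
    (halpha1 : 0 < alpha1) (halpha2 : 0 < alpha2) (halpha4 : 0 < alpha4)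
    (hbeta1 : 0 < beta1) (hbeta2 : 0 < beta2) (hbeta4 : 0 < beta4)
    (* the functions are taken where their series converge absolutely *)
    (hD1 : abs_summable (D1_term gamma1 alpha1 beta1 gamma2 alpha2 gamma3 beta2
             delta1 alpha1 beta1 delta2 alpha4 delta3 beta4 x y))
    (hEx : forall xi : R, 0 < xi < 1 ->
       abs_summable (ML_term gamma2 alpha2 delta2 alpha4 (x * (xi `^ alpha1)%:C)))
    (hEy : forall xi : R, 0 < xi < 1 ->
       abs_summable (ML_term gamma3 beta2 delta3 beta4 (y * (xi `^ beta1)%:C))) :
  let integrand := fun xi : R =>
    cpow xi (gamma1 - 1) * cpow (1 - xi) (delta1 - gamma1 - 1) *
    ML gamma2 alpha2 delta2 alpha4 (x * (xi `^ alpha1)%:C) *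
    ML gamma3 beta2 delta3 beta4 (y * (xi `^ beta1)%:C) in
  cintegrable `]0, 1[ integrand /\
  D1 gamma1 alpha1 beta1 gamma2 alpha2 gamma3 beta2
     delta1 alpha1 beta1 delta2 alpha4 delta3 beta4 x y =
  1 / (Gamma gamma1 * Gamma (delta1 - gamma1)) * cintegral `]0, 1[ integrand.
Proof.
move=> integrand.
pose q := delta1 - gamma1.
have q0 : 0 < complex.Re q by rewrite ReB subr_gt0.
pose D : set (measurableTypeR R) := `]0%R, 1%R[%classic.
have mD : measurable D by exact: measurable_itv.
pose s (p : nat * nat) := alpha1 * p.1%:R + beta1 * p.2%:R.
have s0 p : 0 <= s p by rewrite addr_ge0// mulr_ge0// ltW.
pose a (p : nat * nat) := ML_term gamma2 alpha2 delta2 alpha4 x p.1 *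
                          ML_term gamma3 beta2 delta3 beta4 y p.2.
pose w xi := cpow xi (gamma1 - 1) * cpow (1 - xi) (q - 1).
pose F p xi := w xi *
  (ML_term gamma2 alpha2 delta2 alpha4 (x * (xi `^ alpha1)%:C) p.1 *
   ML_term gamma3 beta2 delta3 beta4 (y * (xi `^ beta1)%:C) p.2).
have Dlt xi : D xi -> 0 < xi < 1 by rewrite /D/= in_itv.
have ps0 p : 0 < complex.Re (gamma1 + (s p)%:C) by rewrite ReD /= ltr_pwDl.
(* The powers of xi in the two series shift the exponent of the weight by s. *)
have FE p xi : D xi -> F p xi = a p * beta_kernel (gamma1 + (s p)%:C) q xi.
  move=> /Dlt/andP[x0 x1]; rewrite /F /w !ML_termZ// /beta_kernel.
  rewrite !mellin_pos ?subr_gt0//.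
  have -> : gamma1 + (s p)%:C - 1 = (gamma1 - 1) + (s p)%:C by ring.
  rewrite (cpowD _ (gamma1 - 1)) (cpow_realC _ x0) /s.
  rewrite powRD; last by rewrite (gt_eqF x0) implybT.
  by rewrite rmorphM /a /=; ring.
have beta_kernel_out p xi : ~ D xi -> a p * beta_kernel (gamma1 + (s p)%:C) q xi = 0.
  move=> nD; have [x0|x0] := leP xi 0.
    by rewrite /beta_kernel mellin_npos// mul0r mulr0.
  rewrite /beta_kernel (@mellin_npos _ q) ?mulr0// subr_le0 leNgt; apply/negP => x1.
  by apply: nD; rewrite /D/= in_itv/= x0.
have ib p := beta_kernel_cintegrable (ps0 p) q0.
have iab p := cintegrableZ (a p) measurableT (ib p).
have iF p : cintegrable D (F p).
  by apply: cintegrable_extend (iab p) => // xi; [move=> /(FE p) ->|exact: beta_kernel_out].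
have IF p : cintegral D (F p) = a p * Beta (gamma1 + (s p)%:C) q.
  rewrite -cintegralZ//; apply: cintegral_extend => xi.
    by move=> /(FE p) ->.
  exact: beta_kernel_out.
have G1 := Gamma_neq0 hgamma1; have Gq := Gamma_neq0 q0.
have Gd p : Gamma (delta1 + (s p)%:C) != 0.
  apply: Gamma_neq0; rewrite ReD /= ltr_pwDl//.
  exact: lt_trans hdelta1.
pose T := D1_term gamma1 alpha1 beta1 gamma2 alpha2 gamma3 beta2
  delta1 alpha1 beta1 delta2 alpha4 delta3 beta4 x y.
have TE p : Gamma gamma1 * T p =
    a p * (Gamma (gamma1 + (s p)%:C) / Gamma (gamma1 + q + (s p)%:C)).
  have -> : gamma1 + q = delta1 by rewrite /q; ring.
  have := Gd p; rewrite /T /a /s; case: p => m n /= Gdp.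
  rewrite /D1_term pochhammer_Re_gt0// /ML_term.
  (* These inverses may be 0, so that field must treat them as atoms. *)
  set u := (Gamma (delta2 + _))^-1; set v := (Gamma (delta3 + _))^-1.
  by field; rewrite G1 Gdp.
pose k := Gamma gamma1 * Gamma q.
have IT p : cintegral D (F p) = k * T p.
  have E : gamma1 + q + (s p)%:C = gamma1 + (s p)%:C + q by ring.
  have Ed : gamma1 + (s p)%:C + q = delta1 + (s p)%:C by rewrite /q; ring.
  have GB := Gamma_Beta (ps0 p) q0.
  have GN : Gamma (gamma1 + (s p)%:C + q) != 0 by rewrite Ed; exact: Gd.
  rewrite IF /k [RHS]mulrAC TE E -[RHS]mulrA; congr (_ * _).
  move: GB GN; move: (Beta _ _) (Gamma q) (Gamma (_ + q)) (Gamma (_ + _%:C)).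
  by move=> B Q Y X GB Y0; rewrite mulrAC GB mulfK.
have sF xi : D xi -> abs_summable (F^~ xi).
  move=> /Dlt xi01; apply: abs_summableZ.
  exact: (abs_summableM (hEx xi xi01) (hEy xi xi01)).
have csF xi : D xi -> csum (F^~ xi) = integrand xi.
  move=> /Dlt xi01; rewrite /F csumZ; last first.
    exact: (abs_summableM (hEx xi xi01) (hEy xi xi01)).
  by rewrite csumM ?mulrA//; [exact: hEx|exact: hEy].
(* The double series itself dominates the integrals of the moduli. *)
have Foo : (\esum_(p in [set: nat * nat])
    \int[@lebesgue_measure R]_(xi in D) (normc (F p xi))%:E < +oo)%E.
  have [K K0 KG] := beta_abs_le hgamma1 q0.
  have bnd p : (\int[@lebesgue_measure R]_(xi in D) (normc (F p xi))%:E <=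
      (K * normc (Gamma gamma1) * normc (T p))%:E)%E.
    rewrite -mulrA -normcM TE normcM mulrCA EFinM integral_mkcond.
    rewrite [leLHS](_ : _ = (normc (a p))%:E * \int[@lebesgue_measure R]_xi
      (normc (beta_kernel (gamma1 + (s p)%:C) q xi))%:E)%E.
      apply: lee_wpmul2l; first by rewrite lee_fin normc_ge0.
      exact: KG.
    rewrite -ge0_integralZl_EFin ?normc_ge0//; last 2 first.
    - by move=> xi _; rewrite lee_fin normc_ge0.
    - by apply/measurable_EFinP; exact: cmeasurable_normc (cmeasurable_beta_kernel _ _).
    apply: eq_integral => xi _; rewrite patchE -EFinM -normcM.
    case: ifPn => [|/negP]; rewrite inE; first by move=> /(FE p) ->.
    by move=> /(beta_kernel_out p) ->; rewrite normc0.
  apply: (@le_lt_trans _ _ (\esum_(p in [set: nat * nat])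
     (K * normc (Gamma gamma1) * normc (T p))%:E)%E).
    by apply: le_esum => p _; exact: bnd.
  rewrite esumZ ?mulr_ge0 ?normc_ge0//; last by move=> p; exact: normc_ge0.
  rewrite lte_mul_pinfty ?lee_fin ?mulr_ge0 ?normc_ge0//.
  move: hD1; rewrite /abs_summable /summable.
  by under eq_esum do rewrite gee0_abs ?lee_fin ?normc_ge0//.
have [iS IS] := csum_cintegral mD
  (fun p => cintegrable_cmeasurable (iF p)) sF Foo.
split; first exact: (eq_cintegrable mD csF iS).
rewrite -(eq_cintegral csF) IS (funext IT) csumZ//.
by rewrite mulrA mul1r mulVf ?mul1r// mulf_neq0.
Qed.
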